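(* Let $\beta\geq\gamma\geq 0$, and let $K$ be an arbitrary measurable subset of $X$ with $\mu(K)=k\in(0,1]$. Then for every non-negative $\phi\in L^p(X,\mu)$ such that $\int_X \phi\, d\mu = f$ and $\int_X \phi^p\, d\mu = F$ the following inequality holds: \[ F\geq \left[ 1-\frac{1}{(1+\gamma)^{p-1}} \right] \int_K \phi^p \, d\mu + \frac{(p-1)\beta}{(\beta+1)^p} \int_X (M_{\mathcal{T}}\phi)^p \, d\mu - \frac{(p-1)\gamma}{(\beta+1)^p} \int_K (M_{\mathcal{T}}\phi)^p \, d\mu + \frac{f^p}{(\beta+1)^{p-1}}. \qquad (\ast) \] Moreover $(\ast)$ is sharp in the following sense: for each $k\in(0,1]$ there exist $\beta,\gamma\geq 0$ with $\beta\geq\gamma$, a sequence $(K_n)_{n\in\mathbb N}$ of measurable subsets of $X$ with $\lim_n \mu(K_n)=k$, and a sequence $(\phi_n)_{n\in\mathbb N}$ of non-negative functions in $L^p(X,\mu)$ with $\int_X \phi_n\, d\mu = f$ and $\int_X \phi_n^p\, d\mu = F$ for all $n$, such that the difference between the two sides of $(\ast)$, written with $\phi=\phi_n$ and $K=K_n$, tends to $0$ as $n\to\infty$ (i.e. equality holds in $(\ast)$ in the limit).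
   Context: Let $(X,\mu)$ be a non-atomic probability space and let $\mathcal T$ be a tree on $X$, i.e. a family of measurable subsets of $X$ such that: $X\in\mathcal T$ and $\mu(I)>0$ for all $I\in\mathcal T$; every $I\in\mathcal T$ has a finite or countable family $C(I)\subseteq\mathcal T$ of at least two pairwise disjoint subsets of $I$ whose union is $I$; $\mathcal T=\bigcup_{m\geq0}\mathcal T_{(m)}$ with $\mathcal T_{(0)}=\{X\}$, $\mathcal T_{(m+1)}=\bigcup_{I\in\mathcal T_{(m)}}C(I)$; $\lim_{m\to\infty}\sup_{I\in\mathcal T_{(m)}}\mu(I)=0$; and $\mathcal T$ differentiates $L^1(X,\mu)$. The dyadic maximal operator is $M_{\mathcal T}\phi(x)=\sup\{\frac{1}{\mu(I)}\int_I|\phi|\,d\mu : x\in I\in\mathcal T\}$. Fix $p>1$ and $f,F$ with $0<f^p\leq F$. *)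

(* Defs.v *)
From HB Require Import structures.
From mathcomp Require Import all_boot all_order all_algebra.
From mathcomp Require Import all_classical all_reals all_analysis.
Set Implicit Arguments. Unset Strict Implicit. Unset Printing Implicit Defensive.
Import Order.TTheory GRing.Theory Num.Theory.
Local Open Scope classical_set_scope.
Local Open Scope ring_scope.

Fixpoint tree_level (X : Type) (C : set X -> set (set X)) (m : nat)
  : set (set X) :=
  match m with
  | 0%N => [set setT]
  | m'.+1 => \bigcup_(I in tree_level C m') C I
  end.

Definition dyadic_tree (X : Type) (C : set X -> set (set X)) : set (set X) :=
  \bigcup_(m in [set: nat]) tree_level C m.

Definition nonatomic d (X : measurableType d) (R : realType)
  (mu : {measure set X -> \bar R}) : Prop :=
  forall A, measurable A -> (0 < mu A)%E ->
    exists2 B, measurable B /\ B `<=` A & (0 < mu B)%E /\ (mu B < mu A)%E.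

Definition avg d (X : measurableType d) (R : realType)
  (mu : {measure set X -> \bar R}) (I : set X) (phi : X -> R) : R :=
  (fine (mu I))^-1 * fine (\int[mu]_(x in I) (phi x)%:E).

Definition differentiates_L1 d (X : measurableType d) (R : realType)
  (mu : {measure set X -> \bar R}) (T : set (set X)) : Prop :=
  forall phi : X -> R, mu.-integrable setT (EFin \o phi) ->
    {ae mu, forall x, forall eps : R, 0 < eps ->
       exists2 delta : R, 0 < delta &
         forall I, T I -> I x -> fine (mu I) < delta ->
           `|avg mu I phi - phi x| < eps}.

Definition is_tree d (X : measurableType d) (R : realType)
  (mu : {measure set X -> \bar R}) (C : set X -> set (set X)) : Prop :=
  let T := dyadic_tree C in
  [/\ (forall I, T I -> measurable I /\ (0 < mu I)%E),
      (forall I, T I ->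
         [/\ countable (C I),
             (exists J1 J2, [/\ C I J1, C I J2 & J1 <> J2]),
             (forall J1 J2, C I J1 -> C I J2 -> J1 <> J2 -> J1 `&` J2 = set0),
             (forall J, C I J -> J `<=` I) &
             \bigcup_(J in C I) J = I]),
      (forall eps : R, 0 < eps -> exists m0 : nat, forall m, (m0 <= m)%N ->
         forall I, tree_level C m I -> (mu I <= eps%:E)%E) &
      differentiates_L1 mu T].

Definition maxop d (X : measurableType d) (R : realType)
  (mu : {measure set X -> \bar R}) (T : set (set X)) (phi : X -> R)
  (x : X) : \bar R :=
  ereal_sup [set ((fine (mu I))^-1)%:E * \int[mu]_(y in I) (`|phi y|)%:E
            | I in [set I | T I /\ I x]]%E.

Definition star_rhs d (X : measurableType d) (R : realType)
  (mu : {measure set X -> \bar R}) (T : set (set X)) (p f beta gamma : R)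
  (K : set X) (phi : X -> R) : \bar R :=
  ((1 - ((1 + gamma) `^ (p - 1))^-1)%:E * \int[mu]_(x in K) ((phi x) `^ p)%:E
   + ((p - 1) * beta / (beta + 1) `^ p)%:E
       * \int[mu]_x (maxop mu T phi x `^ p)
   - ((p - 1) * gamma / (beta + 1) `^ p)%:E
       * \int[mu]_(x in K) (maxop mu T phi x `^ p)
   + (f `^ p / (beta + 1) `^ (p - 1))%:E)%E.

(* Main.v *)
(** Upper bound: let [M_m] be the largest average of [phi] over the cells of
    level at most [m] around a point.  On a cell of level [m+1], [M_(m+1)] is
    either [M_m] or the average of [phi], so convexity of [y `^ p] gives, by
    induction on [m], (p-1) int M_m^p + f^p <= p int phi M_m^(p-1).  Replacing
    phi M_m^(p-1) by its bound from the tangent to x^p at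
    x = M_m (1+gamma)/(1+beta) on [K], and at x = M_m/(1+beta) off [K], yields
    the inequality for [M_m]; monotone convergence does the rest.

    Sharpness: take gamma = 0, which removes [K], and u = 1 + beta solving
    u^p (1 - p (1 - 1/u)) = f^p/F.  Equality then asks for phi = M/u, with [M]
    growing by small steps.  This is approached by nested unions of cells,
    each filling the proportion 1 - alpha of every cell of the previous one, on
    which the average of [phi] is multiplied by rho = 1/(1 - alpha (1 - 1/u)).
    On the last union [phi] is concentrated so as to make its p-th integral
    exactly [F]. *)

Require Import Defs.
From HB Require Import structures.
From mathcomp Require Import all_boot all_order all_algebra.
From mathcomp Require Import all_classical all_reals all_analysis.
From mathcomp Require Import measurable_realfun ring lra.
Set Implicit Arguments.
Unset Strict Implicit.
Unset Printing Implicit Defensive.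

Import Order.TTheory GRing.Theory Num.Theory numFieldNormedType.Exports.
Local Open Scope classical_set_scope.
Local Open Scope ring_scope.

(** * Power inequalities *)

(** Young's inequality for x and t^(p-1) with exponents p and p/(p-1). Geometrically, the graph of
    x^p lies above its tangent at t; this is the only convexity used below. *)
Lemma powR_young (R : realType) (p x t : R) : 1 < p -> 0 <= x -> 0 <= t ->
  p * t `^ (p - 1) * x <= x `^ p + (p - 1) * t `^ p.
Proof.
move=> p1 x0 t0.
have p0 : 0 < p by lra.
have pN0 : p != 0 by rewrite gt_eqF.
have p1N0 : p - 1 != 0 by rewrite subr_eq0 gt_eqF.
have q0 : 0 < p / (p - 1) by rewrite divr_gt0// subr_gt0.
have := @conjugate_powR R x (t `^ (p - 1)) p (p / (p - 1)) x0 (powR_ge0 _ _)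
  p0 q0.
rewrite -powRrM (_ : (p - 1) * (p / (p - 1)) = p); last by field.
rewrite (_ : (p / (p - 1))^-1 = (p - 1) / p); last by field; rewrite pN0.
rewrite (_ : p^-1 + (p - 1) / p = 1); last by field.
move=> /(_ erefl); rewrite -(ler_pM2l p0) => /le_trans h.
rewrite (_ : _ * x = p * (x * t `^ (p - 1))); last by ring.
apply: h; rewrite le_eqVlt; apply/orP; left; apply/eqP.
by field.
Qed.

Lemma powR_bernoulli (R : realType) (p x : R) : 1 < p -> -1 <= x ->
  1 + p * x <= (1 + x) `^ p.
Proof.
move=> p1 x1; have := @powR_young R p (1 + x) 1 p1 ^~ ler01.
rewrite !powR1; have -> : 0 <= 1 + x by lra.
by move=> /(_ isT); lra.
Qed.

(* The tangent to [x `^ p] at [t = y (1 + g) / (1 + b)]. *)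
Lemma powR_tangent (R : realType) (p b g x y : R) :
  1 < p -> 0 <= g -> g <= b -> 0 <= x -> 0 <= y ->
  p * (x * y `^ (p - 1))
   + (1 + b) `^ (p - 1) * (1 - ((1 + g) `^ (p - 1))^-1) * x `^ p
   + (p - 1) * (b - g) / (1 + b) * y `^ p
  <= (1 + b) `^ (p - 1) * x `^ p + (p - 1) * y `^ p.
Proof.
move=> p1 g0 gb x0 y0.
have b0 : 0 < 1 + b by lra.
have g1 : 0 < 1 + g by lra.
set U := (1 + b) `^ (p - 1); set V := (1 + g) `^ (p - 1).
have U0 : 0 < U by exact: powR_gt0.
have V0 : 0 < V by exact: powR_gt0.
have t0 : 0 <= y * ((1 + g) / (1 + b)) by rewrite mulr_ge0// divr_ge0// ltW.
have := powR_young p1 x0 t0.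
have r0 : 0 <= (1 + g) / (1 + b) by rewrite divr_ge0// ltW.
have b10 : 0 <= (1 + b)^-1 by rewrite invr_ge0 ltW.
have hp : ((1 + g) / (1 + b)) `^ (p - 1) = V / U.
  by rewrite powRM ?(ltW g1)// -[(1 + b)^-1]powR_inv1 ?ltW// powRAC powR_inv1 ?powR_ge0.
have hq : ((1 + g) / (1 + b)) `^ p = (1 + g) / (1 + b) * (V / U).
  by rewrite -hp mulr_powRB1//; lra.
(* Young's inequality at t, multiplied by U/V, is the claim up to rearrangement, because 1 -
   (b-g)/(1+b) = (1+g)/(1+b). *)
rewrite !(powRM _ y0 r0) hp hq -(ler_pM2l (divr_gt0 U0 V0)) => h.
rewrite -subr_ge0; move: h; rewrite -subr_ge0 => /le_trans; apply.
rewrite le_eqVlt; apply/orP; left; apply/eqP.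
by field; rewrite !gt_eqF.
Qed.

(** * Cells of a tree *)

Lemma countable_trivIset_enum (X : Type) (A : set (set X)) :
  countable A -> (forall I J, A I -> A J -> I <> J -> I `&` J = set0) ->
  exists F : nat -> set X, [/\ forall n, F n = set0 \/ A (F n),
    trivIset setT F & \bigcup_n F n = \bigcup_(J in A) J].
Proof.
move=> /countable_injP[e einj] disjA.
have eqA I J : A I -> A J -> e I = e J -> I = J.
  by move=> AI AJ; apply: einj; rewrite inE.
pose F n := \bigcup_(J in [set J | A J /\ e J = n]) J.
have FE n J : A J -> e J = n -> F n = J.
  move=> AJ eJ; apply/seteqP; split=> [x [I [AI eI] Ix]|x Jx]; last by exists J.
  by rewrite -(eqA I J) // eI eJ.
exists F; split.
- move=> n; have [[J [AJ eJ]]|h] := pselect (exists J, A J /\ e J = n).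
    by right; rewrite (FE n J).
  left; rewrite -subset0 => x [J [AJ eJ] _]; by apply: h; exists J.
- apply/trivIsetP => m n _ _ mn; rewrite -subset0 => x [].
  move=> [I [AI eI] Ix] [J [AJ eJ] Jx].
  have IJ : I <> J by move=> IJ; move: mn; rewrite -eI -eJ IJ eqxx.
  by rewrite -(disjA _ _ AI AJ IJ); split.
- apply/seteqP; split=> [x [n _ [J [AJ _] Jx]]|x [J AJ Jx]]; first by exists J.
  by exists (e J) => //; exists J.
Qed.

(** The default [set0] is never returned on a tree, since every level covers the space; see
    [cellP]. *)
Definition cell (X : Type) (C : set X -> set (set X)) (m : nat) (x : X) : set X :=
  xget set0 [set I | tree_level C m I /\ I x].

Section tree.
Context {d : measure_display} {X : measurableType d} {R : realType}.
Context {mu : probability X R} {C : set X -> set (set X)}.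
Hypothesis tC : is_tree mu C.

Lemma tree_measurable I : dyadic_tree C I -> measurable I.
Proof. by case: tC => h _ _ _ /h[]. Qed.

Lemma tree_gt0 I : dyadic_tree C I -> (0 < mu I)%E.
Proof. by case: tC => h _ _ _ /h[]. Qed.

Lemma level_tree m I : tree_level C m I -> dyadic_tree C I.
Proof. by exists m. Qed.

Lemma level_measurable m I : tree_level C m I -> measurable I.
Proof. by move=> /level_tree/tree_measurable. Qed.

Lemma tree_child I J : dyadic_tree C I -> C I J -> dyadic_tree C J.
Proof. by move=> [m _ mI] CJ; exists m.+1 => //; exists I. Qed.

Lemma child_sub I J : dyadic_tree C I -> C I J -> J `<=` I.
Proof. by case: tC => _ h _ _ /h[_ _ _ + _]; apply. Qed.

Lemma child_disj I J K : dyadic_tree C I -> C I J -> C I K -> J <> K ->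
  J `&` K = set0.
Proof. by case: tC => _ h _ _ /h[_ _ + _ _]; apply. Qed.

Lemma child_cover I : dyadic_tree C I -> \bigcup_(J in C I) J = I.
Proof. by case: tC => _ h _ _ /h[]. Qed.

Lemma child_countable I : dyadic_tree C I -> countable (C I).
Proof. by case: tC => _ h _ _ /h[]. Qed.

Lemma level_cover m x : exists2 I, tree_level C m I & I x.
Proof.
elim: m => [|m [I mI Ix]]; first by exists setT.
move: Ix; rewrite -(child_cover (level_tree mI)) => -[J CJ Jx].
by exists J => //; exists I.
Qed.

Lemma level_uniq m I J x : tree_level C m I -> tree_level C m J ->
  I x -> J x -> I = J.
Proof.
elim: m I J => [|m IH] I J; first by move=> -> ->.
move=> [I' mI' CI] [J' mJ' CJ] Ix Jx.
have I'J' : I' = J'.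
  apply: (IH I' J') => //; [exact: (child_sub (level_tree mI') CI)|].
  exact: (child_sub (level_tree mJ') CJ).
subst J'; apply: contrapT => IJ.
have : (I `&` J) x by [].
by rewrite (child_disj (level_tree mI') CI CJ IJ).
Qed.

Lemma level_disj m I J : tree_level C m I -> tree_level C m J ->
  I <> J -> I `&` J = set0.
Proof.
move=> mI mJ IJ; rewrite -subset0 => x [Ix Jx]; apply: IJ.
exact: (level_uniq mI mJ Ix Jx).
Qed.

Lemma level_countable m : countable (tree_level C m).
Proof.
elim: m => [|m IH] /=; first exact: countable1.
by apply: bigcup_countable => // I mI; exact: child_countable (level_tree mI).
Qed.

Lemma level_enum m : exists F : nat -> set X,
  [/\ forall n, F n = set0 \/ tree_level C m (F n),
    trivIset setT F & \bigcup_n F n = setT].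
Proof.
have [F [F0 tF FE]] := countable_trivIset_enum (level_countable m)
  (@level_disj m).
exists F; split=> //; rewrite FE; apply/seteqP; split=> // x _.
by have [I mI Ix] := level_cover m x; exists I.
Qed.

Lemma cellP m x : tree_level C m (cell C m x) /\ cell C m x x.
Proof.
have [I mI Ix] := level_cover m x.
by apply: (@xgetPex _ set0 [set I | tree_level C m I /\ I x]); exists I.
Qed.

Lemma cellE m I x : tree_level C m I -> I x -> cell C m x = I.
Proof. by move=> mI Ix; have [mc cx] := cellP m x; exact: (level_uniq mc mI cx Ix). Qed.

Lemma cell_eqS m x y : cell C m.+1 x y -> cell C m x = cell C m y.
Proof.
have [[I mI CI] cx] := cellP m.+1 x => cy.
have IT := level_tree mI.
rewrite (cellE mI (child_sub IT CI cx)).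
by rewrite (cellE mI (child_sub IT CI cy)).
Qed.

(** The cells of a level form a countable measurable partition, and [f] is constant on each of
    them. *)
Lemma level_const_measurable d' (Y : measurableType d') m (f : X -> Y) :
  (forall x y, cell C m x y -> f y = f x) -> measurable_fun setT f.
Proof.
move=> fc; have [F [F0 tF <-]] := level_enum m.
have mF n : measurable (F n).
  by have [->|/level_measurable] := F0 n.
apply/measurable_fun_bigcup => // n.
have [->|/set0P[x Fx]] := eqVneq (F n) set0; first exact: measurable_fun_set0.
have [F0n|mFn] := F0 n; first by move: Fx; rewrite F0n.
apply: (eq_measurable_fun (cst (f x))) => // y /[!inE] Fy.
by rewrite (fc x) // (cellE mFn Fx).
Qed.

Lemma le_integral_level m (f g : X -> \bar R) :
  measurable_fun setT f -> (forall x, 0 <= f x)%E ->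
  measurable_fun setT g -> (forall x, 0 <= g x)%E ->
  (forall I, tree_level C m I ->
    \int[mu]_(x in I) f x <= \int[mu]_(x in I) g x)%E ->
  (\int[mu]_x f x <= \int[mu]_x g x)%E.
Proof.
move=> mf f0 mg g0 fg; have [F [F0 tF FT]] := level_enum m.
have mF n : measurable (F n) by have [->|/level_measurable] := F0 n.
rewrite -FT !ge0_integral_bigcup ?FT //.
apply: lee_nneseries => [n _ _|n _]; first exact: integral_ge0.
by have [->|/fg //] := F0 n; rewrite !integral_set0.
Qed.

End tree.

(** * The maximal operator *)

Lemma ge0_integral_lincomb (d : measure_display) (X : measurableType d)
  (R : realType) (mu : {measure set X -> \bar R}) (D : set X) (a b : R)
  (g h : X -> R) :
  measurable D -> measurable_fun setT g -> measurable_fun setT h ->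
  0 <= a -> 0 <= b -> (forall x, 0 <= g x) -> (forall x, 0 <= h x) ->
  (\int[mu]_(x in D) (a * g x + b * h x)%:E =
   a%:E * \int[mu]_(x in D) (g x)%:E + b%:E * \int[mu]_(x in D) (h x)%:E)%E.
Proof.
move=> mD mg mh a0 b0 g0 h0.
have mgD : measurable_fun D (EFin \o g).
  by apply/measurable_EFinP; exact: measurable_funS mg.
have mhD : measurable_fun D (EFin \o h).
  by apply/measurable_EFinP; exact: measurable_funS mh.
under eq_integral do rewrite EFinD !EFinM.
rewrite ge0_integralD //.
- by rewrite !ge0_integralZl_EFin// => x _; rewrite lee_fin.
- by move=> x _; rewrite -EFinM lee_fin mulr_ge0.
- exact: measurable_funeM.
- by move=> x _; rewrite -EFinM lee_fin mulr_ge0.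
- exact: measurable_funeM.
Qed.

Section maximal.
Context {d : measure_display} {X : measurableType d} {R : realType}.
Context {mu : probability X R} {C : set X -> set (set X)}.
Hypothesis tC : is_tree mu C.
Variables (p : R) (phi : X -> R).
Hypotheses (p1 : 1 < p) (mphi : measurable_fun setT phi).
Hypotheses (phi0 : forall x, 0 <= phi x).
Hypothesis intphi : (\int[mu]_x (phi x)%:E < +oo)%E.
Hypothesis intphip : (\int[mu]_x (phi x `^ p)%:E < +oo)%E.

Let p0 : 0 < p. Proof. exact: lt_trans p1. Qed.
Let pm1 : 0 <= p - 1. Proof. by rewrite subr_ge0 ltW. Qed.

Lemma probability_fineK I : measurable I -> (fine (mu I))%:E = mu I.
Proof. by move=> mI; rewrite fineK// fin_num_measure. Qed.

Lemma tree_fine_gt0 I : dyadic_tree C I -> 0 < fine (mu I).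
Proof.
move=> TI; rewrite -lte_fin probability_fineK; last exact: (tree_measurable tC TI).
exact: (tree_gt0 tC TI).
Qed.

Lemma avg_ge0 I : 0 <= avg mu I phi.
Proof.
by rewrite /avg mulr_ge0 ?invr_ge0 ?fine_ge0// integral_ge0// => x _; rewrite lee_fin.
Qed.

Lemma integral_sub_lty D (g : X -> R) : measurable D -> measurable_fun setT g ->
  (forall x, 0 <= g x) -> (\int[mu]_x (g x)%:E < +oo)%E ->
  (\int[mu]_(x in D) (g x)%:E < +oo)%E.
Proof.
move=> mD mg g0; apply: le_lt_trans; apply: ge0_subset_integral => //.
- exact/measurable_EFinP.
- by move=> x _; rewrite lee_fin.
Qed.

Lemma integral_avg I : dyadic_tree C I ->
  (\int[mu]_(x in I) (phi x)%:E = (avg mu I phi * fine (mu I))%:E)%E.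
Proof.
move=> TI; rewrite /avg mulrAC mulVf ?mul1r; last by rewrite gt_eqF// tree_fine_gt0.
rewrite fineK// ge0_fin_numE; last by apply: integral_ge0 => x _; rewrite lee_fin.
by apply: integral_sub_lty => //; exact: (tree_measurable tC TI).
Qed.

Lemma integral_affine I a b : dyadic_tree C I -> 0 <= a -> 0 <= b ->
  (\int[mu]_(x in I) (a * 1 + b * phi x)%:E =
   ((a + b * avg mu I phi) * fine (mu I))%:E)%E.
Proof.
move=> TI a0 b0; have mI := tree_measurable tC TI.
rewrite (@ge0_integral_lincomb _ _ _ _ _ a b (fun=> 1))// integral_avg//.
rewrite integral_cst// mul1e [X in (_ * X + _)%E](esym (probability_fineK mI)).
rewrite -!EFinM. by rewrite -EFinD mulrDl mulrA.
Qed.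

(** Doob's running maximum for the martingale of conditional expectations of [phi] given the
    levels. *)
Fixpoint runmax m x := match m with
  | 0 => avg mu (cell C 0 x) phi
  | m'.+1 => Num.max (runmax m' x) (avg mu (cell C m x) phi)
  end.

Lemma runmax_ge0 m x : 0 <= runmax m x.
Proof. by elim: m => [|m IH] /=; rewrite ?le_max ?avg_ge0 ?orbT. Qed.

Lemma runmax_ge m x : avg mu (cell C m x) phi <= runmax m x.
Proof. by case: m => [//|m] /=; rewrite le_max lexx orbT. Qed.

Lemma runmax_nd x : nondecreasing_seq (runmax ^~ x).
Proof. by apply/nondecreasing_seqP => n /=; rewrite le_max lexx. Qed.

Lemma runmax_const m x y : cell C m x y -> runmax m y = runmax m x.
Proof.
elim: m x y => [|m IH] x y cy.
  by rewrite /= (cellE tC (cellP tC 0 x).1 cy).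
rewrite /= (cellE tC (cellP tC m.+1 x).1 cy) (IH x)//.
by rewrite (cell_eqS tC cy); exact: (cellP tC m y).2.
Qed.

Lemma measurable_runmax m : measurable_fun setT (runmax m).
Proof. by apply: (level_const_measurable tC (m := m)) => x y /runmax_const. Qed.

Lemma measurable_powR_comp (g : X -> R) r : measurable_fun setT g ->
  measurable_fun setT (fun x => g x `^ r).
Proof. by move=> mg; apply: (measurableT_comp (measurable_powR r)). Qed.

Let mM r m : measurable_fun setT (fun x => runmax m x `^ r).
Proof. exact/measurable_powR_comp/measurable_runmax. Qed.

Lemma cell_tree m x : dyadic_tree C (cell C m x).
Proof. exact: (level_tree (cellP tC m x).1). Qed.

Lemma avg_normE I : dyadic_tree C I -> (((fine (mu I))^-1)%:E *
  \int[mu]_(y in I) (`|phi y|)%:E = (avg mu I phi)%:E)%E.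
Proof.
move=> TI; under eq_integral do rewrite ger0_norm//.
rewrite integral_avg// -EFinM mulrCA mulVf ?mulr1//.
by rewrite gt_eqF// tree_fine_gt0.
Qed.

Lemma avg_le_maxop I x : dyadic_tree C I -> I x ->
  ((avg mu I phi)%:E <= maxop mu (dyadic_tree C) phi x)%E.
Proof.
by move=> TI Ix; apply: ereal_sup_ubound; exists I => //; exact: avg_normE.
Qed.

(** A tree cell containing x is the cell of x at its own level, so the supremum over cells is a
    supremum over levels. *)
Lemma maxop_runmax x : maxop mu (dyadic_tree C) phi x =
  ereal_sup (range (fun m => (runmax m x)%:E)).
Proof.
apply/eqP; rewrite eq_le; apply/andP; split.
  apply: ge_ereal_sup => _ [I [TI Ix] <-]; rewrite avg_normE//.
  case: TI => m _ mI; apply: (@le_trans _ _ (runmax m x)%:E).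
    by rewrite lee_fin -(cellE tC mI Ix) runmax_ge.
  by apply: ereal_sup_ubound; exists m.
apply: ge_ereal_sup => _ [m _ <-].
have avgle k : ((avg mu (cell C k x) phi)%:E <=
    maxop mu (dyadic_tree C) phi x)%E.
  by apply: avg_le_maxop; [exact: cell_tree|exact: (cellP tC k x).2].
elim: m => [|m IH] /=; first exact: avgle.
by rewrite EFin_max ge_max IH avgle.
Qed.

Lemma cvg_runmax_powR x :
  (runmax m x `^ p)%:E @[m --> \oo] --> (maxop mu (dyadic_tree C) phi x `^ p)%E.
Proof.
rewrite maxop_runmax.
have -> : (ereal_sup (range (fun m => (runmax m x)%:E)) `^ p)%E =
    ereal_sup (range (fun m => (runmax m x `^ p)%:E)).
  apply/eqP; rewrite eq_le; apply/andP; split.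
    set S := ereal_sup (range (fun m => (runmax m x `^ p)%:E)).
    have S0 : (0 <= S)%E.
      apply: (@le_trans _ _ (runmax 0 x `^ p)%:E).
        by rewrite lee_fin powR_ge0.
      by apply: ereal_sup_ubound; exists 0%N.
    (* The power is moved through the supremum by comparing p-th roots, in the extended reals since
       the supremum may be infinite. *)
    have -> : S = ((S `^ p^-1) `^ p)%E.
      by rewrite -poweRrM mulVf ?poweRe1// gt_eqF.
    apply: gt0_ler_poweR; first exact: ltW.
    - rewrite in_itv /= leey andbT; apply: (@le_trans _ _ (runmax 0 x)%:E).
        by rewrite lee_fin runmax_ge0.
      by apply: ereal_sup_ubound; exists 0%N.
    - by rewrite in_itv /= leey andbT poweR_ge0.
    - apply: ge_ereal_sup => _ [m _ <-].
      have -> : ((runmax m x)%:E = ((runmax m x `^ p)%:E `^ p^-1))%E.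
        by rewrite poweR_EFin -powRrM mulfV ?gt_eqF// powRr1// runmax_ge0.
      apply: gt0_ler_poweR; first by rewrite invr_ge0 ltW.
      + by rewrite in_itv /= leey andbT lee_fin powR_ge0.
      + by rewrite in_itv /= leey andbT.
      + by apply: ereal_sup_ubound; exists m.
  apply: ge_ereal_sup => _ [m _ <-]; rewrite -poweR_EFin.
  apply: gt0_ler_poweR; first exact: ltW.
  - by rewrite in_itv /= leey andbT lee_fin runmax_ge0.
  - rewrite in_itv /= leey andbT; apply: (@le_trans _ _ (runmax 0 x)%:E).
      by rewrite lee_fin runmax_ge0.
    by apply: ereal_sup_ubound; exists 0%N.
  - by apply: ereal_sup_ubound; exists m.
apply: ereal_nondecreasing_cvgn => m n mn; rewrite lee_fin.
by apply: ge0_ler_powR; rewrite ?nnegrE ?runmax_ge0 ?(ltW p0)//; exact: runmax_nd.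
Qed.

Lemma integral_sub_fineK D (g : X -> R) : measurable D -> measurable_fun setT g ->
  (forall x, 0 <= g x) -> (\int[mu]_x (g x)%:E < +oo)%E ->
  (\int[mu]_(x in D) (g x)%:E = (fine (\int[mu]_(x in D) (g x)%:E))%:E)%E.
Proof.
move=> mD mg g0 gy; apply/esym/fineK; rewrite ge0_fin_numE.
  exact: integral_sub_lty.
by apply: integral_ge0 => x _; rewrite lee_fin.
Qed.

Let mphip : measurable_fun setT (fun x => phi x `^ p).
Proof. exact: measurable_powR_comp. Qed.

(** Jensen's inequality, obtained by integrating over [I] the tangent bound of [powR_young] at t
    equal to the average. *)
Lemma jensen_avg I : dyadic_tree C I ->
  ((avg mu I phi `^ p * fine (mu I))%:E <= \int[mu]_(x in I) (phi x `^ p)%:E)%E.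
Proof.
move=> TI; have mI := tree_measurable tC TI.
set a := avg mu I phi; have a0 : 0 <= a := avg_ge0 I.
have := integral_sub_fineK mI mphip (fun x => powR_ge0 _ _) intphip.
set v := fine _ => vE; rewrite vE.
have : (\int[mu]_(x in I) (0 * 1 + p * a `^ (p - 1) * phi x)%:E <=
    \int[mu]_(x in I) (1 * phi x `^ p + (p - 1) * a `^ p * 1)%:E)%E.
  apply: ge0_le_integral => //.
  - by move=> x _; rewrite lee_fin mul0r add0r !mulr_ge0// ?powR_ge0// ltW.
  - apply/measurable_EFinP; apply: measurable_funS (@subsetT _ _) _ => //.
    by apply: measurable_funD => //; exact: measurable_funM.
  - apply/measurable_EFinP; apply: measurable_funS (@subsetT _ _) _ => //.
    by apply: measurable_funD => //; apply: measurable_funM => //.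
  - by move=> x _; rewrite lee_fin mul0r add0r mul1r mulr1 powR_young.
rewrite integral_affine//; last by rewrite mulr_ge0 ?powR_ge0// ltW.
have c0 : 0 <= (p - 1) * a `^ p by rewrite mulr_ge0// powR_ge0.
rewrite (@ge0_integral_lincomb _ _ _ _ _ 1 ((p - 1) * a `^ p) (fun x => phi x `^ p) (fun=> 1))//;
  last by move=> x; exact: powR_ge0.
rewrite vE integral_cst// !mul1e [X in (_ <= _ + _ * X)%E](esym (probability_fineK mI)).
rewrite -EFinM -EFinD !lee_fin -/a add0r -(mulr_powRB1 a0 p0) => h.
by rewrite -(lerD2r ((p - 1) * (a * a `^ (p - 1)) * fine (mu I))); lra.
Qed.

Let avgm m x := avg mu (cell C m x) phi.

Let mavgm m : measurable_fun setT (avgm m).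
Proof.
apply: (level_const_measurable tC (m := m)) => x y cy.
by rewrite /avgm (cellE tC (cellP tC m x).1 cy).
Qed.

(** The averages of one level are controlled by Jensen, and the p-th power of a maximum is at most
    the sum of the p-th powers. The bound depends on [m]; a uniform one comes with [maxop_Lp]. *)
Lemma runmax_Lp m : (\int[mu]_x (runmax m x `^ p)%:E < +oo)%E.
Proof.
have avgp k : (\int[mu]_x (avgm k x `^ p)%:E < +oo)%E.
  apply: le_lt_trans intphip; apply: (le_integral_level tC (m := k)).
  - exact/measurable_EFinP/measurable_powR_comp.
  - by move=> x; rewrite lee_fin powR_ge0.
  - exact/measurable_EFinP.
  - by move=> x; rewrite lee_fin powR_ge0.
  - move=> I kI; rewrite (eq_integral (cst (avg mu I phi `^ p)%:E)); last first.
      by move=> x /[!inE] Ix; rewrite /avgm (cellE tC kI Ix).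
    have mI := level_measurable tC kI.
    rewrite integral_cst// [X in (_ * X <= _)%E](esym (probability_fineK mI)).
    by rewrite -EFinM jensen_avg//; exact: level_tree kI.
elim: m => [|m IH]; first exact: avgp.
apply: (@le_lt_trans _ _ (\int[mu]_x (1 * runmax m x `^ p + 1 * avgm m.+1 x `^ p)%:E)%E).
  apply: ge0_le_integral => //.
  - by move=> x _; rewrite lee_fin powR_ge0.
  - exact/measurable_EFinP/(mM p m.+1).
  - apply/measurable_EFinP; apply: measurable_funD; apply: measurable_funM => //.
    exact: measurable_powR_comp.
  - move=> x _; rewrite lee_fin !mul1r /= maxEle; case: ifP => _.
      by rewrite lerDr powR_ge0.
    by rewrite lerDl powR_ge0.
rewrite (@ge0_integral_lincomb _ _ _ _ _ 1 1 (fun x => runmax m x `^ p) (fun x => avgm m.+1 x `^ p))//.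
- by rewrite !mul1e; apply: (lte_add_pinfty IH); exact: avgp.
- exact: measurable_powR_comp.
- by move=> x; exact: powR_ge0.
- by move=> x; exact: powR_ge0.
Qed.

Let q := p - 1.
Let phiM m x := phi x * runmax m x `^ q.

Let mphiM m : measurable_fun setT (phiM m).
Proof. exact: measurable_funM. Qed.

Let phiM_ge0 m x : 0 <= phiM m x.
Proof. by rewrite mulr_ge0// powR_ge0. Qed.

Lemma phi_runmax_lty m : (\int[mu]_x (phi x * runmax m x `^ (p - 1))%:E < +oo)%E.
Proof.
apply: (@le_lt_trans _ _ (\int[mu]_x (1 * phi x `^ p + (p - 1) * runmax m x `^ p)%:E)%E).
  apply: ge0_le_integral => //.
  - by move=> x _; rewrite lee_fin phiM_ge0.
  - exact/measurable_EFinP/mphiM.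
  - by apply/measurable_EFinP; apply: measurable_funD; apply: measurable_funM.
  - move=> x _; rewrite lee_fin mul1r.
    apply: le_trans (powR_young p1 (phi0 x) (runmax_ge0 m x)).
    rewrite mulrAC -mulrA ler_peMl ?phiM_ge0//; exact: ltW.
rewrite (@ge0_integral_lincomb _ _ _ _ _ 1 (p - 1) (fun x => phi x `^ p) (fun x => runmax m x `^ p))//.
- rewrite mul1e; apply: (lte_add_pinfty intphip).
  by apply: lte_mul_pinfty; [rewrite lee_fin| |exact: runmax_Lp].
- by move=> x; exact: powR_ge0.
- by move=> x; exact: powR_ge0.
Qed.

(** Increment of Doob's inequality from level m to m+1. The terms are arranged so that no
    subtraction occurs in the extended reals. *)
Lemma runmax_step m :
  (\int[mu]_x ((p - 1) * runmax m.+1 x `^ p + p * (phi x * runmax m x `^ (p - 1)))%:E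
   <= \int[mu]_x ((p - 1) * runmax m x `^ p + p * (phi x * runmax m.+1 x `^ (p - 1)))%:E)%E.
Proof.
have mF k l : measurable_fun setT (fun x => ((p - 1) * runmax k x `^ p +
    p * (phi x * runmax l x `^ (p - 1)))%:E).
  apply/measurable_EFinP; apply: measurable_funD; apply: measurable_funM => //.
  exact: mphiM.
have F0 k l x : (0 <= ((p - 1) * runmax k x `^ p +
    p * (phi x * runmax l x `^ (p - 1)))%:E)%E.
  by rewrite lee_fin addr_ge0// mulr_ge0 ?powR_ge0 ?phiM_ge0// ltW.
apply: (le_integral_level tC (m := m.+1) (mF _ _) (F0 _ _) (mF _ _) (F0 _ _)).
move=> I mI.
have [->|/set0P[x Ix]] := eqVneq I set0; first by rewrite !integral_set0.
have TI := level_tree mI.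
have cI : cell C m.+1 x = I := cellE tC mI Ix.
pose u := runmax m x; pose v := runmax m.+1 x; pose a := avg mu I phi.
have vE : v = Num.max u a by rewrite /v /= cI.
have vI y : I y -> runmax m.+1 y = v by rewrite -cI => /runmax_const.
have uI y : I y -> runmax m y = u.
  move=> Iy; apply: runmax_const; rewrite (cell_eqS tC (x := x) (y := y)) ?cI//.
  exact: (cellP tC m y).2.
rewrite (eq_integral (fun y => ((p - 1) * v `^ p * 1 + p * u `^ (p - 1) * phi y)%:E)); last first.
  by move=> y /[!inE] Iy; rewrite vI// uI//; congr (_ %:E); ring.
rewrite [leRHS](eq_integral (fun y => ((p - 1) * u `^ p * 1 + p * v `^ (p - 1) * phi y)%:E)); last first.
  by move=> y /[!inE] Iy; rewrite vI// uI//; congr (_ %:E); ring.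
rewrite !integral_affine ?mulr_ge0 ?powR_ge0 ?(ltW p0)// lee_fin -/a.
(* If the maximum stays at u, both sides coincide; if it becomes a, the claim is Young's inequality
   with x = a and t = u. *)
rewrite ler_pM2r ?tree_fine_gt0// vE maxEle; case: ifP => [_|_]; last by [].
have a0 : 0 <= a := avg_ge0 I.
have := powR_young p1 a0 (runmax_ge0 m x); rewrite -/u.
by rewrite -(mulr_powRB1 a0 p0); lra.
Qed.

(** Induction with [runmax_step]. At level 0 the running maximum is the constant f and equality
    holds. *)
Lemma runmax_doob m f : (\int[mu]_x (phi x)%:E = f%:E)%E ->
  (p - 1) * fine (\int[mu]_x (runmax m x `^ p)%:E)%E + f `^ p <=
  p * fine (\int[mu]_x (phi x * runmax m x `^ (p - 1))%:E)%E.
Proof.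
move=> phif; have TX : dyadic_tree C setT by exists 0%N.
have mT : fine (mu setT) = 1 by exact: (congr1 fine (probability_setT mu)).
have fE : avg mu setT phi = f.
  by rewrite /avg phif mT invr1 mul1r.
have f0 : 0 <= f by rewrite -fE avg_ge0.
have K (g : X -> R) := @integral_sub_fineK setT g measurableT.
have r0 x : runmax 0 x = f by rewrite /= (cellE tC (m := 0) (I := setT)).
elim: m => [|m IH].
  under eq_integral do rewrite r0.
  under [X in _ <= _ * fine X]eq_integral do rewrite r0.
  rewrite integral_cst// [X in (_ * X)%E](probability_setT mu) mule1 /=.
  rewrite (eq_integral (fun x => (0 * 1 + f `^ (p - 1) * phi x)%:E)); last first.
    by move=> x _; rewrite mul0r add0r mulrC.
  rewrite integral_affine ?powR_ge0// mT /= fE.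
  by rewrite -(mulr_powRB1 f0 p0); lra.
have E k l : (\int[mu]_x ((p - 1) * runmax k x `^ p +
    p * (phi x * runmax l x `^ (p - 1)))%:E)%E =
    ((p - 1) * fine (\int[mu]_x (runmax k x `^ p)%:E)%E +
     p * fine (\int[mu]_x (phi x * runmax l x `^ (p - 1))%:E)%E)%:E.
  have := ge0_integral_lincomb mu measurableT (mM p k) (mphiM l)
    pm1 (ltW p0) (fun x => powR_ge0 _ _) (phiM_ge0 l).
  move=> ->; rewrite [in RHS]EFinD ![in RHS]EFinM; congr (_ * _ + _ * _)%E; apply: K.
  - exact: mM.
  - by move=> x; exact: powR_ge0.
  - exact: runmax_Lp.
  - exact: mphiM.
  - exact: phiM_ge0.
  - exact: phi_runmax_lty.
have := runmax_step m; rewrite !E lee_fin.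
have aux (a a' b b' c : R) : a + c <= b -> a' + b <= a + b' -> a' + c <= b'.
  by lra.
exact: aux IH.
Qed.

End maximal.

Arguments runmax {d X R} mu C phi m x.

(** * The inequality for all beta >= gamma >= 0 *)

Section star_inequality.
Context {d : measure_display} {X : measurableType d} {R : realType}.
Context {mu : probability X R} {C : set X -> set (set X)}.
Hypothesis tC : is_tree mu C.
Variables (p f F : R) (phi : X -> R).
Hypotheses (p1 : 1 < p) (mphi : measurable_fun setT phi).
Hypotheses (phi0 : forall x, 0 <= phi x).
Hypothesis phif : (\int[mu]_x (phi x)%:E = f%:E)%E.
Hypothesis phiF : (\int[mu]_x (phi x `^ p)%:E = F%:E)%E.

Local Notation M := (runmax mu C phi).
Local Notation Mstar := (maxop mu (dyadic_tree C) phi).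

Let p0 : 0 <= p. Proof. by rewrite ltW// (lt_trans _ p1). Qed.
Let pm1 : 0 <= p - 1. Proof. by rewrite subr_ge0 ltW. Qed.
Let intphi : (\int[mu]_x (phi x)%:E < +oo)%E.
Proof. by rewrite phif ltry. Qed.
Let intphip : (\int[mu]_x (phi x `^ p)%:E < +oo)%E.
Proof. by rewrite phiF ltry. Qed.

Let mphip : measurable_fun setT (fun x => phi x `^ p).
Proof. exact: measurable_powR_comp. Qed.
Let phip0 x : 0 <= phi x `^ p. Proof. exact: powR_ge0. Qed.

Let mMr r m : measurable_fun setT (fun x => M m x `^ r).
Proof. exact/measurable_powR_comp/(measurable_runmax tC). Qed.
Let Mp0 m x : 0 <= M m x `^ p. Proof. exact: powR_ge0. Qed.

Let phiM m x := phi x * M m x `^ (p - 1).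
Let mphiM m : measurable_fun setT (phiM m).
Proof. exact: measurable_funM. Qed.
Let phiM0 m x : 0 <= phiM m x.
Proof. by rewrite mulr_ge0// powR_ge0. Qed.

Let A D := fine (\int[mu]_(x in D) (phi x `^ p)%:E)%E.
Let B m D := fine (\int[mu]_(x in D) (M m x `^ p)%:E)%E.
Let E m D := fine (\int[mu]_(x in D) (phiM m x)%:E)%E.

Let AE D : measurable D -> (\int[mu]_(x in D) (phi x `^ p)%:E)%E = (A D)%:E.
Proof. by move=> mD; exact: (integral_sub_fineK mD mphip phip0 intphip). Qed.

Let BE m D : measurable D -> (\int[mu]_(x in D) (M m x `^ p)%:E)%E = (B m D)%:E.
Proof.
move=> mD; apply: (integral_sub_fineK mD (mMr p m) (Mp0 m)).
exact: (runmax_Lp tC).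
Qed.

Let EE m D : measurable D -> (\int[mu]_(x in D) (phiM m x)%:E)%E = (E m D)%:E.
Proof.
move=> mD; apply: (integral_sub_fineK mD (mphiM m) (phiM0 m)).
exact: (phi_runmax_lty tC).
Qed.

Let splitC (g : X -> R) K : measurable K -> measurable_fun setT g ->
  (forall x, 0 <= g x) ->
  (\int[mu]_x (g x)%:E =
   \int[mu]_(x in K) (g x)%:E + \int[mu]_(x in ~` K) (g x)%:E)%E.
Proof.
move=> mK mg g0; rewrite -ge0_integral_setU ?setUv//.
- exact: measurableC.
- exact/measurable_EFinP.
- by move=> x _; rewrite lee_fin.
- by rewrite disj_set2E setICr.
Qed.

Let A_split K : measurable K -> F = A K + A (~` K).
Proof.
move=> mK; apply: EFin_inj; rewrite -phiF (splitC mK mphip phip0).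
by rewrite !AE//; exact: measurableC.
Qed.

Let B_split m K : measurable K -> B m setT = B m K + B m (~` K).
Proof.
move=> mK; apply: EFin_inj; rewrite -BE// (splitC mK (mMr p m) (Mp0 m)).
by rewrite !BE//; exact: measurableC.
Qed.

Let E_split m K : measurable K -> E m setT = E m K + E m (~` K).
Proof.
move=> mK; apply: EFin_inj; rewrite -EE// (splitC mK (mphiM m) (phiM0 m)).
by rewrite !EE//; exact: measurableC.
Qed.

(** Integrated form of [powR_tangent], to be used with gamma on [K] and with 0 on the complement. *)
Lemma integral_tangent (b g : R) m D : measurable D -> 0 <= g -> g <= b ->
  p * E m D + (1 + b) `^ (p - 1) * (1 - ((1 + g) `^ (p - 1))^-1) * A D
   + (p - 1) * (b - g) / (1 + b) * B m D
  <= (1 + b) `^ (p - 1) * A D + (p - 1) * B m D.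
Proof.
move=> mD g0 gb; rewrite -lee_fin.
set U := (1 + b) `^ (p - 1); set c := 1 - _; set e := _ / (1 + b).
have U0 : 0 <= U by exact: powR_ge0.
have g1 : 1 <= (1 + g) `^ (p - 1).
  rewrite -{1}(powRr0 (1 + g)); apply: ler_powR => //.
  by rewrite lerDl.
have c0 : 0 <= U * c.
  rewrite mulr_ge0// subr_ge0 invf_le1//; exact: lt_le_trans g1.
have b0 : 0 <= b by exact: le_trans gb.
have e0 : 0 <= e by rewrite divr_ge0 ?mulr_ge0// ?subr_ge0// addr_ge0.
(* [ge0_integral_lincomb] treats two summands at a time, so the first two are grouped. *)
pose G x := p * phiM m x + U * c * phi x `^ p.
have mG : measurable_fun setT G.
  by apply: measurable_funD; apply: measurable_funM.
have G0 x : 0 <= G x by rewrite addr_ge0// mulr_ge0.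
have HG := ge0_integral_lincomb mu mD mG (mMr p m) ler01 e0 G0 (Mp0 m).
have HG' := ge0_integral_lincomb mu mD (mphiM m) mphip p0 c0 (phiM0 m) phip0.
have HH := ge0_integral_lincomb mu mD mphip (mMr p m) U0 pm1 phip0 (Mp0 m).
rewrite mul1e HG' EE// AE// BE// -!EFinM -!EFinD in HG.
rewrite AE// BE// -!EFinM -!EFinD in HH.
rewrite -HG -HH; apply: ge0_le_integral => //.
- by move=> x _; rewrite lee_fin addr_ge0// mulr_ge0.
- apply/measurable_EFinP; apply: measurable_funS (@subsetT _ _) _ => //.
  by apply: measurable_funD; apply: measurable_funM.
- apply/measurable_EFinP; apply: measurable_funS (@subsetT _ _) _ => //.
  by apply: measurable_funD; apply: measurable_funM.
- move=> x _; rewrite lee_fin mul1r /G /phiM.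
  by apply: powR_tangent => //; exact: runmax_ge0.
Qed.

(** The two tangent bounds, on [K] and off [K], are added to [runmax_doob]: the integrals of phi
    M^(p-1) cancel, and division by (1+b)^(p-1) leaves the claim. Splitting along [K] keeps all
    coefficients nonnegative. *)
Lemma star_runmax (b g : R) m K : measurable K -> 0 <= g -> g <= b ->
  (1 - ((1 + g) `^ (p - 1))^-1) * A K + (p - 1) * b / (b + 1) `^ p * B m (~` K)
   + (p - 1) * (b - g) / (b + 1) `^ p * B m K + f `^ p / (b + 1) `^ (p - 1) <= F.
Proof.
move=> mK g0 gb; have mK' := measurableC mK.
have b0 : 0 <= b by exact: le_trans gb.
have b1 : 0 < 1 + b by rewrite ltr_pwDl.
have U0 : 0 < (1 + b) `^ (p - 1) by exact: powR_gt0.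
have := integral_tangent m mK g0 gb.
have := integral_tangent m mK' (lexx 0) b0.
have := runmax_doob tC p1 mphi phi0 intphi intphip m phif.
rewrite -/(B m setT) -/(E m setT) (B_split m mK) (E_split m mK).
rewrite addr0 powR1 invr1 subrr mulr0 mul0r subr0 (A_split mK).
rewrite (addrC b 1) -[(1 + b) `^ p]mulr_powRB1 ?(ltW b1)//; last exact: lt_trans p1.
move: (B m K) (B m (~` K)) (E m K) (E m (~` K)) (A K) (A (~` K)) => BK BK' EK EK' AK AK'.
set U := _ `^ (p - 1) in U0 *; set c := 1 - _.
move=> h1 h2 h3; rewrite -(ler_pM2l U0).
have -> : U * (c * AK + (p - 1) * b / ((1 + b) * U) * BK' +
    (p - 1) * (b - g) / ((1 + b) * U) * BK + f `^ p / U) =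
    U * c * AK + (p - 1) * b / (1 + b) * BK' + (p - 1) * (b - g) / (1 + b) * BK
    + f `^ p.
  by field; rewrite !gt_eqF.
by rewrite -/c in h3 *; clearbody c; lra.
Qed.

Let cvgB D : measurable D ->
  (B m D)%:E @[m --> \oo] --> (\int[mu]_(x in D) (Mstar x `^ p))%E.
Proof.
move=> mD.
have -> : (fun m => (B m D)%:E) = (fun m => \int[mu]_(x in D) (M m x `^ p)%:E)%E.
  by apply/funext => m; rewrite BE.
rewrite (eq_integral (fun x => limn (fun m => (M m x `^ p)%:E))); last first.
  move=> x _; apply/esym/cvg_lim => //.
  exact: (cvg_runmax_powR tC p1 mphi phi0 intphi).
apply: cvg_monotone_convergence => //.
- by move=> m; apply/measurable_EFinP; apply: measurable_funS (mMr p m).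
- by move=> m x _; rewrite lee_fin.
- move=> x _ m n mn; rewrite lee_fin.
  by apply: ge0_ler_powR; rewrite ?nnegrE ?runmax_ge0//; exact: runmax_nd.
Qed.

Let B0 m D : 0 <= B m D.
Proof. by rewrite fine_ge0// integral_ge0// => x _; rewrite lee_fin. Qed.

(** The inequality itself gives the maximal theorem: with b = 1, g = 0 and K = X it bounds the
    integral of M_m^p by F/e uniformly in m, and the bound passes to the limit. *)
Lemma maxop_Lp D : measurable D ->
  (\int[mu]_(x in D) (Mstar x `^ p))%E \is a fin_num.
Proof.
move=> mD; rewrite ge0_fin_numE; last by apply: integral_ge0 => x _; exact: poweR_ge0.
set e := (p - 1) * (1 - 0) / (1 + 1) `^ p.
have e0 : 0 < e.
  by rewrite divr_gt0 ?powR_gt0// ?addr_gt0// mulr_gt0 ?subr_gt0.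
apply: (@le_lt_trans _ _ (F / e)%:E); last exact: ltry.
apply: (cvge_to_le (cvgB mD)); apply: nearW => m; rewrite lee_fin ler_pdivlMr// mulrC.
have BT : B m D <= B m setT by rewrite (B_split m mD) lerDl.
have := star_runmax m measurableT (lexx 0) ler01.
rewrite addr0 powR1 invr1 subrr mul0r add0r -/e setCT.
have : 0 <= f `^ p / (1 + 1) `^ (p - 1) by rewrite divr_ge0// powR_ge0.
have : 0 <= (p - 1) * 1 / (1 + 1) `^ p * B m set0.
  by rewrite mulr_ge0// divr_ge0 ?powR_ge0// mulr1.
have : e * B m D <= e * B m setT by rewrite ler_pM2l.
by lra.
Qed.

(** All integrals being finite, the limit of [star_runmax] is taken in the reals. There the
    coefficients b off [K] and b - g on [K] recombine into b on the whole space minus g on [K]. *)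
Lemma star_inequality (b g : R) K : measurable K -> 0 <= g -> g <= b ->
  (star_rhs mu (dyadic_tree C) p f b g K phi <= F%:E)%E.
Proof.
move=> mK g0 gb; have mK' := measurableC mK.
have cv D : measurable D -> B m D @[m --> \oo] -->
    fine (\int[mu]_(x in D) (Mstar x `^ p))%E.
  move=> mD; have := cvgB mD; rewrite -{1}(fineK (maxop_Lp mD)) => /fine_cvg.
  exact.
have cK := cv K mK; have cK' := cv _ mK'; have cT := cv _ measurableT.
have cTE : fine (\int[mu]_x (Mstar x `^ p))%E =
    fine (\int[mu]_(x in K) (Mstar x `^ p))%E +
    fine (\int[mu]_(x in ~` K) (Mstar x `^ p))%E.
  apply: (cvg_unique _ cT) => //.
  rewrite (_ : (fun m => B m setT) = (fun m => B m K + B m (~` K))).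
    exact: cvgD.
  by apply/funext => m; exact: B_split.
rewrite /star_rhs AE//.
rewrite -(fineK (maxop_Lp measurableT)) -(fineK (maxop_Lp mK)) cTE.
move: cK cK'; set bK := fine _; set bK' := fine _ => cK cK'.
rewrite -!EFinM -!EFinD lee_fin.
have : (1 - ((1 + g) `^ (p - 1))^-1) * A K + (p - 1) * b / (b + 1) `^ p * bK'
   + (p - 1) * (b - g) / (b + 1) `^ p * bK + f `^ p / (b + 1) `^ (p - 1) <= F.
  set c1 := 1 - _; set c2 := _ / _; set c3 := _ / (b + 1) `^ p; set c4 := _ / _.
  have lim : c1 * A K + c2 * B m (~` K) + c3 * B m K + c4 @[m --> \oo] -->
      c1 * A K + c2 * bK' + c3 * bK + c4.
    apply: cvgD; last exact: cvg_cst.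
    apply: cvgD; last exact: cvgMl_tmp cK.
    by apply: cvgD; [exact: cvg_cst|exact: cvgMl_tmp cK'].
  apply: (cvgr_to_le lim); apply: nearW => m.
  exact: (star_runmax m mK g0 gb).
apply: le_trans; rewrite le_eqVlt; apply/orP; left; apply/eqP.
by ring.
Qed.

End star_inequality.

(** * Splitting a cell *)

Section splitting.
Context {d : measure_display} {X : measurableType d} {R : realType}.
Context {mu : probability X R} {C : set X -> set (set X)}.
Hypothesis tC : is_tree mu C.

Lemma tree_countable : countable (dyadic_tree C).
Proof. by apply: bigcup_countable => // m _; exact: (level_countable tC). Qed.

(* Greedy step: keep children of [Q], in some enumeration, as long as their
   total measure is at most [r]; [J] is the first child that does not fit. *)
Lemma split_children Q (r : R) : dyadic_tree C Q -> 0 <= r < fine (mu Q) ->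
  exists S J, [/\ S `<=` C Q, C Q J, ~ S J,
    measurable (\bigcup_(K in S) K) &
    fine (mu (\bigcup_(K in S) K)) <= r <
      fine (mu (\bigcup_(K in S) K)) + fine (mu J)].
Proof.
move=> TQ /andP[r0 rQ]; have mQ := tree_measurable tC TQ.
have cQ := child_countable tC TQ; move/countable_injP : (cQ) => [e einj].
have mC K : C Q K -> measurable K.
  by move=> QK; exact: (tree_measurable tC (tree_child TQ QK)).
pose S n := [set K | C Q K /\ (e K < n)%N].
pose E n := \bigcup_(K in S n) K.
have mE n : measurable (E n).
  have cS : countable (S n).
    by apply: sub_countable cQ; apply: subset_card_le => K [].
  have dS K L : S n K -> S n L -> K <> L -> K `&` L = set0.
    by move=> [QK _] [QL _]; exact: (child_disj tC TQ).
  have [F [F0 _ FE]] := countable_trivIset_enum cS dS.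
  rewrite /E -FE; by apply: bigcup_measurable => k _; have [->|[/mC]] := F0 k.
have EQ : \bigcup_n E n = Q.
  rewrite -[RHS](child_cover tC TQ); apply/seteqP; split=> x.
    by move=> [n _ [K [QK _] Kx]]; exists K.
  by move=> [K QK Kx]; exists (e K).+1 => //; exists K.
have ndE : nondecreasing_seq E.
  by move=> m n mn; apply/subsetPset => x [K [QK Km] Kx]; exists K => //;
    split=> //; exact: leq_trans mn.
have cvE : mu \o E @ \oo --> mu Q.
  by rewrite -EQ; apply: nondecreasing_cvg_mu => //; rewrite EQ.
(* The sets [E n] increase to [Q], whose measure exceeds [r]. The least index that overshoots is
   some m+1, and the child with code m is the [J] sought. *)
have [n rEn] : exists n, (r%:E < mu (E n))%E.
  apply: contrapT => /forallNP h; move: rQ; rewrite ltNge => /negP; apply.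
  rewrite -lee_fin probability_fineK//.
  apply: (cvge_to_le cvE); apply: nearW => n /=; rewrite leNgt.
  by apply/negP; exact: h.
case: (ex_minnP (ex_intro (fun n => r%:E < mu (E n))%E n rEn)) => -[|m] rEm minm.
  move: rEm; rewrite [E 0](_ : _ = set0) ?measure0 ?lte_fin ?ltNge ?r0//.
  by rewrite -subset0 => x [K [_]].
have Emr : (mu (E m) <= r%:E)%E.
  by rewrite leNgt; apply/negP => /minm; rewrite ltnn.
have [J [QJ eJ]] : exists J, C Q J /\ e J = m.
  apply: contrapT => /forallNP h; move: rEm; rewrite ltNge => /negP; apply.
  apply: le_trans Emr; apply: le_measure; rewrite ?inE// => x [K [QK Km] Kx].
  exists K => //; split=> //; rewrite ltn_neqAle -ltnS Km andbT.
  by apply/eqP => eK; apply: (h K).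
exists (S m), J; split=> //.
- by move=> K [].
- by move=> [_]; rewrite eJ ltnn.
- exact: mE.
- apply/andP; split; first by rewrite -lee_fin (probability_fineK (mE m)).
  rewrite -lte_fin EFinD (probability_fineK (mE m)) (probability_fineK (mC _ QJ)).
  rewrite -measureU//; [|exact: mC|].
    apply: lt_le_trans rEm _; apply: le_measure; rewrite ?inE//.
      by apply: measurableU => //; exact: mC.
    move=> x [K [QK Km] Kx]; have [eK|/eqP eK] := pselect (e K = m).
      by right; rewrite -(einj K J) ?inE// eK.
    left; exists K => //; split=> //.
    by rewrite ltn_neqAle eK -ltnS.
  rewrite -subset0 => x [[K [QK Km] Kx] Jx].
  have KJ : K <> J by move=> KJ; move: Km; rewrite KJ eJ ltnn.
  by rewrite -(child_disj tC TQ QK QJ KJ).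
Qed.

(** The greedy step is iterated: the kept children leave a remainder smaller than the measure of
    [J], and the search continues inside [J]. The remainder tends to 0 because the measures of cells
    tend to 0 uniformly with the level. *)
Lemma split_tree_lt I (r : R) : dyadic_tree C I -> 0 <= r < fine (mu I) ->
  exists F : nat -> set X,
    [/\ forall n, F n = set0 \/ dyadic_tree C (F n) /\ F n `<=` I,
        trivIset setT F & mu (\bigcup_n F n) = r%:E].
Proof.
move=> [m0 _ mI] rI.
have /choice[h hP] : forall s : set X * R, exists y : set (set X) * set X,
    dyadic_tree C s.1 -> 0 <= s.2 < fine (mu s.1) ->
    [/\ y.1 `<=` C s.1, C s.1 y.2, ~ y.1 y.2,
    measurable (\bigcup_(K in y.1) K) &
    fine (mu (\bigcup_(K in y.1) K)) <= s.2 <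
      fine (mu (\bigcup_(K in y.1) K)) + fine (mu y.2)].
  move=> [Q t] /=.
  have [[TQ tQ]|] := pselect (dyadic_tree C Q /\ 0 <= t < fine (mu Q)).
    by have [S [J SJ]] := split_children TQ tQ; exists (S, J).
  by move=> n; exists (set0, set0) => TQ tQ; exfalso; apply: n.
pose U s := \bigcup_(K in (h s).1) K.
(* A state is the current cell together with the measure still to be collected inside it. *)
pose st := fix st n := if n is n'.+1 then
  ((h (st n')).2, (st n').2 - fine (mu (U (st n')))) else (I, r).
have inv n : tree_level C (m0 + n) (st n).1 /\ 0 <= (st n).2 < fine (mu (st n).1).
  elim: n => [|n [IH1 IH2]]; first by rewrite addn0.
  have [SQ QJ _ mU /andP[U1 U2]] := hP _ (level_tree IH1) IH2.
  split; first by rewrite addnS /=; exists (st n).1.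
  by rewrite /= subr_ge0 U1 ltrBlDl U2.
have T_ n := level_tree (inv n).1.
have H n := hP _ (T_ n) (inv n).2.
have decr m n : (m <= n)%N -> (st n).1 `<=` (st m).1.
  elim: n m => [|n IH] m; first by rewrite leqn0 => /eqP ->.
  rewrite leq_eqVlt => /predU1P[->//|]; rewrite ltnS => /IH.
  by apply: subset_trans; have [_ + _ _ _] := H n; exact: (child_sub tC (T_ n)).
have disj_next n K : (h (st n)).1 K -> K `&` (st n.+1).1 = set0.
  have [SQ QJ nS _ _] := H n => SK.
  by apply: (child_disj tC (T_ n) (SQ _ SK) QJ) => KJ; apply: nS; rewrite -KJ.
have subQ n K : (h (st n)).1 K -> K `<=` (st n).1.
  by have [SQ _ _ _ _] := H n => /SQ; exact: (child_sub tC (T_ n)).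
have disj_lt m n K L : (m < n)%N -> (h (st m)).1 K -> (h (st n)).1 L ->
    K `&` L = set0.
  move=> mn SK SL; rewrite -subset0 => x [Kx Lx].
  rewrite -(disj_next _ _ SK); split=> //.
  by apply: (decr m.+1 n mn); exact: subQ Lx.
pose A := \bigcup_n (h (st n)).1.
have AT : A `<=` dyadic_tree C.
  move=> K [n _ SK]; have [SQ _ _ _ _] := H n.
  exact: (tree_child (T_ n) (SQ _ SK)).
have cA : countable A.
  by apply: sub_countable tree_countable; exact: subset_card_le.
have dA K L : A K -> A L -> K <> L -> K `&` L = set0.
  move=> [m _ SK] [n _ SL] KL; case: (ltngtP m n) => mn.
  - exact: disj_lt mn SK SL.
  - by rewrite setIC; exact: disj_lt mn SL SK.
  - subst n; have [SQ _ _ _ _] := H m.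
    exact: (child_disj tC (T_ m) (SQ _ SK) (SQ _ SL) KL).
have [F [F0 tF FE]] := countable_trivIset_enum cA dA.
exists F; split=> // [n|].
  have [|AF] := F0 n; [by left|right; split; first exact: AT].
  case: AF => k _ SF; apply: subset_trans (decr 0%N k (leq0n k)).
  exact: subQ.
have UE : \bigcup_n F n = \bigcup_n U (st n).
  rewrite FE; apply/seteqP; split=> x.
    by move=> [K [n _ SK] Kx]; exists n => //; exists K.
  by move=> [n _ [K SK Kx]]; exists K => //; exists n.
have mU n : measurable (U (st n)) by have [_ _ _ + _] := H n.
have tU : trivIset setT (U \o st).
  apply/trivIsetP => i j _ _ ij; rewrite -subset0 => x [[K SK Kx] [L SL Lx]].
  move: ij; rewrite neq_ltn => /orP[] ij.
    by rewrite -(disj_lt _ _ _ _ ij SK SL).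
  by rewrite -(disj_lt _ _ _ _ ij SL SK).
rewrite UE measure_semi_bigcup//; last exact: bigcup_measurable.
apply/cvg_lim => //.
(* The partial sums telescope: what has been collected is [r] minus the current remainder. *)
have -> : (fun n => \sum_(0 <= i < n) mu (U (st i)))%E =
    EFin \o (fun n => r - (st n).2).
  apply/funext => n /=; elim: n => [|n IH]; first by rewrite big_nil subrr.
  rewrite big_nat_recr//= IH -[X in (_ + X)%E](probability_fineK (mU n)) -EFinD.
  by congr (_ %:E); ring.
apply: cvg_EFin; first exact: nearW.
rewrite /comp /= -[X in _ --> X]subr0.
apply: cvgB; first exact: cvg_cst.
apply/cvgrPdist_le => eps eps0.
have [_ _ /(_ _ eps0)[M0 hM] _] := tC.
exists M0 => // n /= Mn; rewrite sub0r normrN.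
have [lev /andP[r0 rQ]] := inv n; rewrite ger0_norm//.
apply: (le_trans (ltW rQ)); rewrite -lee_fin probability_fineK.
  by apply: hM lev; rewrite (leq_trans Mn)// leq_addl.
exact: (level_measurable tC lev).
Qed.

(** When [r] is the full measure every child fits and the greedy step has no [J]; the cell itself is
    then taken. *)
Lemma split_tree I (r : R) : dyadic_tree C I -> 0 <= r <= fine (mu I) ->
  exists F : nat -> set X,
    [/\ forall n, F n = set0 \/ dyadic_tree C (F n) /\ F n `<=` I,
        trivIset setT F & mu (\bigcup_n F n) = r%:E].
Proof.
move=> TI /andP[r0]; rewrite le_eqVlt => /predU1P[->|rI]; last first.
  by apply: split_tree_lt => //; rewrite r0.
exists (fun n => if n is 0%N then I else set0); split.
- move=> [|n]; last by left.
  by right; split=> // x.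
- by apply/trivIsetP => -[|m] [|n]// _ _ _; rewrite ?setI0 ?set0I.
- rewrite (_ : \bigcup_n _ = I) ?probability_fineK//.
    exact: (tree_measurable tC).
  by apply/seteqP; split=> [x [[|n] _]|x Ix]//; exists 0%N.
Qed.

End splitting.

(** * Extremal functions *)

Section glue.
Context {d : measure_display} {X : measurableType d} {R : realType}.
Variables (mu : probability X R) (F : nat -> set X) (H : nat -> X -> R) (c : R).
Hypotheses (mF : forall n, measurable (F n)) (tF : trivIset setT F).

(** Disjointness of the pieces makes the index picked by [xget] the only possible one; its default 0
    is never reached inside the union. *)
Definition glue x := if x \in \bigcup_n F n
  then H (xget 0%N [set n | F n x]) x else c.

Lemma glue_in n x : F n x -> glue x = H n x.
Proof.
move=> Fx; rewrite /glue ifT; last by rewrite inE; exists n.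
congr (H _ x); apply: (xget_unique _ Fx) => m Fm.
by apply: (tF _ _) => //; exists x.
Qed.

Lemma glue_out x : ~ (\bigcup_n F n) x -> glue x = c.
Proof. by move=> Fx; rewrite /glue ifF//; apply/negbTE; rewrite notin_setE. Qed.

Lemma measurable_glue : (forall n, measurable_fun setT (H n)) ->
  measurable_fun setT glue.
Proof.
move=> mH; have mU : measurable (\bigcup_n F n) by exact: bigcup_measurable.
rewrite -(setUv (\bigcup_n F n)).
apply/measurable_funU => //; first exact: measurableC.
split.
  apply/measurable_fun_bigcup => // n.
  apply: (eq_measurable_fun (H n)); first by move=> x /[!inE] Fx; rewrite (glue_in Fx).
  exact: measurable_funS (mH n).
by apply: (eq_measurable_fun (cst c)) => // x /[!inE] Fx; rewrite glue_out.
Qed.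

Lemma glue_ge0 : 0 <= c -> (forall n x, 0 <= H n x) -> forall x, 0 <= glue x.
Proof. by move=> c0 H0 x; rewrite /glue; case: ifP. Qed.

End glue.

(** Computes integrals of glued functions. [G] only needs the common mean k on the pieces, expressed
    without division so that empty pieces qualify. *)
Lemma integral_cell_const (d : measure_display) (X : measurableType d)
  (R : realType) (mu : probability X R) (F : nat -> set X) (G : X -> R)
  (I : set X) (k c : R) :
  (forall n, measurable (F n)) -> trivIset setT F -> measurable I ->
  \bigcup_n F n `<=` I -> measurable_fun setT G -> (forall x, 0 <= G x) ->
  0 <= k ->
  (forall n, \int[mu]_(x in F n) (G x)%:E = k%:E * mu (F n))%E ->
  (forall x, I x -> ~ (\bigcup_n F n) x -> G x = c) ->
  (\int[mu]_(x in I) (G x)%:E =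
   (k * fine (mu (\bigcup_n F n))
    + c * (fine (mu I) - fine (mu (\bigcup_n F n))))%:E)%E.
Proof.
move=> mF tF mI FI mG G0 k0 Gk Gc.
set U := \bigcup_n F n; have mU : measurable U by exact: bigcup_measurable.
have mG' D : measurable_fun D (EFin \o G).
  by apply/measurable_EFinP; exact: measurable_funS mG.
have mD : measurable (I `\` U) by exact: measurableD.
rewrite -{1}(setDUK FI) ge0_integral_setU//; last 2 first.
- by move=> x _; rewrite lee_fin.
- by rewrite disj_set2E setDIK.
rewrite ge0_integral_bigcup//; last by move=> x _; rewrite lee_fin.
under eq_eseriesr do rewrite Gk.
rewrite nneseriesZl// -measure_semi_bigcup// -/U.
rewrite (eq_integral (cst c%:E)); last by move=> x /[!inE] -[Ix Ux]; rewrite /= Gc.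
rewrite integral_cst//.
have fin D : measurable D -> exists r, mu D = r%:E.
  by move=> mD'; exists (fine (mu D)); rewrite probability_fineK.
have [u uE] := fin U mU; have [i iE] := fin I mI; have [e eE] := fin _ mD.
have : mu I = (mu U + mu (I `\` U))%E.
  by rewrite -measureU// ?setDUK// setDIK.
rewrite uE iE eE -EFinD => -[ieq].
transitivity (k%:E * u%:E + c%:E * e%:E)%E; first by congr (_ * _ + _ * _)%E.
by rewrite -!EFinM -EFinD /= ieq; congr (_%:E); ring.
Qed.

(** Infinite [y] are covered: [fine] then sends both sides to 0. *)
Lemma fineZ (R : realType) (a : R) (y : \bar R) : 0 < a ->
  fine (a%:E * y)%E = a * fine y.
Proof.
by case: y => [r| |] a0 //=; rewrite ?gt0_muley ?gt0_muleNy ?lte_fin// mulr0.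
Qed.

Section extremal.
Context {d : measure_display} {X : measurableType d} {R : realType}.
Context {mu : probability X R} {C : set X -> set (set X)}.
Hypothesis tC : is_tree mu C.
Variables (p alpha rho c : R).
Hypotheses (p1 : 1 < p) (alpha0 : 0 < alpha) (alpha1 : alpha < 1).
Hypotheses (rho0 : 0 < rho) (c0 : 0 < c).
Hypothesis mean1 : alpha * c + (1 - alpha) * rho = 1.

(** If a function equals c on the fraction alpha and rho times functions of p-th moment s on the
    rest, its p-th moment is a + q s. The hypothesis [sstar_fix] makes the range s >= sstar stable
    when this relation is solved backwards. *)
Let q := (1 - alpha) * rho `^ p.
Let a := alpha * c `^ p.
Variable sstar : R.
Hypotheses (sstar1 : 1 <= sstar) (sstar_fix : a + q * sstar <= sstar).

(** The normalized p-th moment of the minorant after N steps: it is 1 on the fraction alpha and rho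
    times the previous minorant on the rest, starting from 0. *)
Fixpoint moment N := if N is N'.+1
  then alpha + (1 - alpha) * rho `^ p * moment N' else 0.

Let T := dyadic_tree C.

(* [g] minorizes the maximal function of [phi] relative to [I].  Only cells
   inside [I] are used, so that [g] survives when [phi] is glued into a
   function on a larger cell. *)
Definition extremal_pair (s m : R) (I : set X) (phi g : X -> R) := [/\
  (measurable_fun setT phi /\ measurable_fun setT g),
  (forall x, 0 <= phi x) /\ (forall x, 0 <= g x),
  (\int[mu]_(x in I) (phi x)%:E = mu I /\
   \int[mu]_(x in I) (phi x `^ p)%:E = s%:E * mu I)%E,
  (\int[mu]_(x in I) (g x `^ p)%:E = m%:E * mu I)%E &
  forall x, I x -> exists Q, [/\ T Q, Q x, Q `<=` I & g x <= avg mu Q phi]].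

Let p0 : p != 0. Proof. by rewrite gt_eqF// (lt_trans _ p1). Qed.

Let cell_family I (r : R) : T I -> 0 <= r <= fine (mu I) ->
  exists F : nat -> set X,
    [/\ forall n, F n = set0 \/ T (F n) /\ F n `<=` I,
        (forall n, measurable (F n)), trivIset setT F,
        \bigcup_n F n `<=` I & mu (\bigcup_n F n) = r%:E].
Proof.
move=> TI /(split_tree tC TI)[F [F0 tF FE]]; exists F; split=> //.
  by move=> n; have [->//|[TF _]] := F0 n; exact: (tree_measurable tC TF).
by move=> x [n _]; have [->//|[_]] := F0 n; exact.
Qed.

(** Concentration: [phi] is t on a union of cells filling the proportion 1/t of [I] and 0 elsewhere.
    Its mean is 1 and its p-th moment is t^(p-1), which dictates t; s >= 1 ensures 1/t <= 1. *)
Lemma extremal_pair0 s I : 1 <= s -> T I ->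
  exists phi g, extremal_pair s 0 I phi g.
Proof.
move=> s1 TI; have mI := tree_measurable tC TI.
have s0 : 0 <= s by exact: le_trans s1.
have pm1 : 0 < p - 1 by rewrite subr_gt0.
pose t := s `^ (p - 1)^-1.
have t1 : 1 <= t.
  apply: (@le_trans _ _ (1 `^ (p - 1)^-1)); first by rewrite powR1.
  by rewrite ge0_ler_powR ?nnegrE ?invr_ge0 ?(ltW pm1).
have t0 : 0 < t by exact: lt_le_trans t1.
have ts : t `^ p = t * s.
  rewrite -mulr_powRB1 ?(ltW t0)//; last exact: lt_trans p1.
  by rewrite -powRrM mulVf ?gt_eqF// powRr1.
have [F [F0 mF tF FI FE]] : exists F : nat -> set X, [/\
    forall n, F n = set0 \/ T (F n) /\ F n `<=` I,
    (forall n, measurable (F n)), trivIset setT F,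
    \bigcup_n F n `<=` I & mu (\bigcup_n F n) = (fine (mu I) / t)%:E].
  apply: cell_family => //; rewrite divr_ge0 ?fine_ge0 ?(ltW t0)//=.
  by rewrite ler_pdivrMr// ler_peMr// fine_ge0.
pose phi := glue F (fun=> cst t) 0.
have mphi : measurable_fun setT phi by exact: measurable_glue.
have phi0 x : 0 <= phi x by apply: glue_ge0 => // n y; exact: ltW.
have cstF (h : X -> R) k n : (forall x, F n x -> h x = k) ->
    (\int[mu]_(x in F n) (h x)%:E = k%:E * mu (F n))%E.
  move=> hk; rewrite (eq_integral (cst k%:E)) ?integral_cst// => x /[!inE] Fx.
  by rewrite /= hk.
have phiF n x : F n x -> phi x = t by move=> Fx; rewrite /phi (glue_in _ _ tF Fx).
exists phi, (cst 0); split=> //.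
- split.
    rewrite (@integral_cell_const _ _ _ mu F phi I t 0) ?(ltW t0)//.
    + by rewrite FE /= mul0r addr0 mulrCA mulfV ?gt_eqF// mulr1 probability_fineK.
    + by move=> n; apply: cstF => x /phiF.
    + by move=> x _ Fx; exact: glue_out.
  rewrite (@integral_cell_const _ _ _ mu F (fun x => phi x `^ p) I (t `^ p) 0)//.
  + rewrite FE /= mul0r addr0 ts (_ : t * s * (fine (mu I) / t) = s * fine (mu I)).
      by rewrite EFinM probability_fineK.
    by field; rewrite gt_eqF.
  + exact: measurable_powR_comp.
  + by move=> x; exact: powR_ge0.
  + exact: powR_ge0.
  + by move=> n; apply: cstF => x /phiF ->.
  + by move=> x _ Fx; rewrite /phi glue_out// powR0.
- by rewrite mul0e integral0_eq// => x _; rewrite powR0.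
- by move=> x Ix; exists I; split=> //; exact: avg_ge0.
Qed.

(** Pairs given on cells filling the proportion 1 - alpha of [I] are multiplied by rho and glued
    with the constants c for [phi] and 1 for [g]. The hypothesis ranges over all s >= sstar because
    the moment needed on the pieces differs from [s]. *)
Lemma extremal_pairS s m I : sstar <= s -> 0 <= m ->
  (forall s J, sstar <= s -> T J -> exists phi g, extremal_pair s m J phi g) ->
  T I -> exists phi g, extremal_pair s (alpha + q * m) I phi g.
Proof.
move=> ss m0 IH TI; have mI := tree_measurable tC TI.
have q0 : 0 < q by rewrite mulr_gt0 ?powR_gt0// subr_gt0.
(* Forced by s = a + q s'; [sstar_fix] gives s' >= sstar. *)
pose s' := (s - a) / q.
have ss' : sstar <= s'.
  rewrite ler_pdivlMr// lerBrDr mulrC addrC; exact: le_trans ss.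
have s'0 : 0 <= s' by apply: le_trans ss'; exact: le_trans sstar1.
have [F [F0 mF tF FI FE]] : exists F : nat -> set X, [/\
    forall n, F n = set0 \/ T (F n) /\ F n `<=` I,
    (forall n, measurable (F n)), trivIset setT F,
    \bigcup_n F n `<=` I & mu (\bigcup_n F n) = ((1 - alpha) * fine (mu I))%:E].
  apply: cell_family => //; rewrite mulr_ge0 ?fine_ge0 ?subr_ge0 ?(ltW alpha1)//=.
  by rewrite ler_piMl ?fine_ge0// gerBl ltW.
(* Indices with an empty piece get zero functions, so measurability and sign hold for every n while
   the pair property is claimed only for cells. *)
have /choice[h hP] : forall n, exists y : (X -> R) * (X -> R),
    [/\ measurable_fun setT y.1, measurable_fun setT y.2,
      (forall x, 0 <= y.1 x), (forall x, 0 <= y.2 x) &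
      T (F n) -> extremal_pair s' m (F n) y.1 y.2].
  move=> n; have [TF|nTF] := pselect (T (F n)); last first.
    by exists (cst 0, cst 0); split=> //; exact: measurable_cst.
  have [phi [g [[? ?] [? ?] ? ? ?]]] := IH s' (F n) ss' TF.
  by exists (phi, g); split.
have rhoZ (w : X -> R) (k l : R) n (w' : X -> R) : measurable_fun setT w -> (forall x, 0 <= w x) ->
    0 <= l -> (T (F n) -> \int[mu]_(x in F n) (w x)%:E = k%:E * mu (F n))%E ->
    (forall x, F n x -> w' x = l * w x) ->
    (\int[mu]_(x in F n) (w' x)%:E = (l * k)%:E * mu (F n))%E.
  move=> mw w0 l0 wk ww'; have [->|[TF _]] := F0 n.
    by rewrite integral_set0 measure0 mule0.
  rewrite (eq_integral (fun x => l%:E * (w x)%:E)%E); last first.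
    by move=> x /[!inE] Fx; rewrite ww'.
  rewrite ge0_integralZl_EFin//.
  - by rewrite wk// muleA.
  - by move=> x _; rewrite lee_fin.
  - by apply/measurable_EFinP; exact: measurable_funS mw.
pose phi := glue F (fun n x => rho * (h n).1 x) c.
pose g := glue F (fun n x => rho * (h n).2 x) 1.
have mphi : measurable_fun setT phi.
  by apply: measurable_glue => // n; have [? _ _ _ _] := hP n; exact: measurable_funM.
have mg : measurable_fun setT g.
  by apply: measurable_glue => // n; have [_ ? _ _ _] := hP n; exact: measurable_funM.
have phi0 x : 0 <= phi x.
  apply: glue_ge0 => [|n y]; first exact: ltW.
  by have [_ _ ? _ _] := hP n; rewrite mulr_ge0// ltW.
have g0 x : 0 <= g x.
  apply: glue_ge0 => [//|n y].
  by have [_ _ _ ? _] := hP n; rewrite mulr_ge0// ltW.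
have phiF n x : F n x -> phi x = rho * (h n).1 x.
  by move=> Fx; rewrite /phi (glue_in _ _ tF Fx).
have gF n x : F n x -> g x = rho * (h n).2 x.
  by move=> Fx; rewrite /g (glue_in _ _ tF Fx).
have phip0 x : 0 <= phi x `^ p by exact: powR_ge0.
have gp0 x : 0 <= g x `^ p by exact: powR_ge0.
have rhop0 : 0 <= rho `^ p by exact: powR_ge0.
have rs0 : 0 <= rho `^ p * s' by exact: mulr_ge0.
have rm0 : 0 <= rho `^ p * m by exact: mulr_ge0.
have mphip := measurable_powR_comp p mphi.
have mgp := measurable_powR_comp p mg.
have int1 : (\int[mu]_(x in I) (phi x)%:E = mu I)%E.
  rewrite (@integral_cell_const _ _ _ mu F phi I rho c) ?(ltW rho0)//.
  - rewrite FE /= -[RHS](probability_fineK mI); congr (_%:E).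
    transitivity ((alpha * c + (1 - alpha) * rho) * fine (mu I)); first by ring.
    by rewrite mean1 mul1r.
  - move=> n; have [? _ ? _ e] := hP n.
    rewrite -[X in X%:E]mulr1; apply: (rhoZ (h n).1) => //.
    + exact: ltW.
    + by rewrite mul1e => /e[_ _ []].
    + exact: phiF.
  - by move=> x _ Fx; exact: glue_out.
have int2 : (\int[mu]_(x in I) (phi x `^ p)%:E = s%:E * mu I)%E.
  rewrite (@integral_cell_const _ _ _ mu F (fun x => phi x `^ p) I (rho `^ p * s') (c `^ p))//.
  - rewrite FE /= -[X in (_ = _ * X)%E](probability_fineK mI) -EFinM; congr (_%:E).
    rewrite /s' /a /q; field; rewrite !gt_eqF ?powR_gt0 ?subr_gt0//.
  - move=> n; have [? _ h0 _ e] := hP n.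
    apply: (rhoZ (fun x => (h n).1 x `^ p)) => //.
    + exact: measurable_powR_comp.
    + by move=> x; exact: powR_ge0.
    + by move=> /e[_ _ []].
    + by move=> x /phiF ->; rewrite powRM// ltW.
  - by move=> x _ Fx; rewrite /phi glue_out.
have int3 : (\int[mu]_(x in I) (g x `^ p)%:E = (alpha + q * m)%:E * mu I)%E.
  rewrite (@integral_cell_const _ _ _ mu F (fun x => g x `^ p) I (rho `^ p * m) 1)//.
  - rewrite FE /= -[X in (_ = _ * X)%E](probability_fineK mI) -EFinM; congr (_%:E).
    by rewrite /q; ring.
  - move=> n; have [_ ? _ h0 e] := hP n.
    apply: (rhoZ (fun x => (h n).2 x `^ p)) => //.
    + exact: measurable_powR_comp.
    + by move=> x; exact: powR_ge0.
    + by move=> /e[].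
    + by move=> x /gF ->; rewrite powRM// ltW.
  - by move=> x _ Fx; rewrite /g glue_out// powR1.
exists phi, g; split=> // x Ix.
(* Off the pieces the cell [I] itself, of average 1, serves as witness; on a piece the witness lies
   inside it, where all averages are scaled by rho. *)
have [[n _ Fx]|nFx] := pselect ((\bigcup_n F n) x); last first.
  exists I; split=> //; rewrite /g glue_out// /avg int1 mulVf// gt_eqF//.
  exact: (tree_fine_gt0 tC TI).
have [Fn0|[TF FnI]] := F0 n; first by move: Fx; rewrite Fn0.
have [mh _ h0 _ e] := hP n; have [_ _ _ _ /(_ x Fx)[Q [TQ Qx QF gQ]]] := e TF.
exists Q; split=> //; first exact: subset_trans FnI.
have mQ := tree_measurable tC TQ.
rewrite (gF _ _ Fx) /avg (eq_integral (fun y => rho%:E * ((h n).1 y)%:E)%E); last first.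
  by move=> y /[!inE] Qy; rewrite (phiF n)//; exact: QF.
rewrite ge0_integralZl_EFin ?(ltW rho0)//; last 2 first.
- by move=> y _; rewrite lee_fin.
- by apply/measurable_EFinP; exact: measurable_funS mh.
by rewrite fineZ// mulrCA ler_pM2l.
Qed.

Lemma moment_ge0 N : 0 <= moment N.
Proof.
elim: N => [//|N IH] /=; rewrite addr_ge0 ?(ltW alpha0)// mulr_ge0//.
by rewrite mulr_ge0 ?powR_ge0// subr_ge0 ltW.
Qed.

Lemma extremal_pair_exists N s I : sstar <= s -> T I ->
  exists phi g, extremal_pair s (moment N) I phi g.
Proof.
elim: N s I => [|N IH] s I ss TI.
  by apply: extremal_pair0 => //; exact: le_trans ss.
by apply: extremal_pairS => //; exact: moment_ge0.
Qed.

End extremal.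

Arguments extremal_pair {d X R} mu C p s m I phi g.

(** * Parameters of the construction *)

Lemma exists_growth (R : realType) (p v : R) : 1 < p -> 0 < v -> v <= 1 ->
  exists2 u : R, 1 <= u & v = u `^ p * (1 - p * (1 - u^-1)).
Proof.
move=> p1 v0 v1.
have p0 : 0 < p by exact: lt_trans p1.
(* With u = e^t the equation becomes h t = 0. Here h 0 = v - 1 <= 0, while at [b] the subtracted
   term vanishes, so h b >= 0 and the intermediate value theorem applies. *)
pose h (t : R) := v * expR (- (p * t)) - (1 - p + p * expR (- t)).
pose b := ln (p / (p - 1)).
have pp : 1 <= p / (p - 1) by rewrite ler_pdivlMr ?subr_gt0// mul1r gerBl.
have b0 : 0 <= b by exact: ln_ge0.
have h0 : h 0 <= 0 by rewrite /h mulr0 oppr0 expR0; lra.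
have hb : 0 <= h b.
  rewrite /h [expR (- b)]expRN lnK ?posrE ?(lt_le_trans ltr01 pp)// invf_div.
  rewrite (_ : 1 - p + p * ((p - 1) / p) = 0); first by rewrite subr0 mulr_ge0 ?expR_ge0// ltW.
  by field; rewrite gt_eqF.
have ch : continuous h.
  move=> t; apply: cvgB.
    apply: cvgMl_tmp; apply: continuous_comp; last exact: continuous_expR.
    by apply: cvgN; apply: cvgMl_tmp; exact: cvg_id.
  apply: cvgD; first exact: cvg_cst.
  apply: cvgMl_tmp; apply: continuous_comp; last exact: continuous_expR.
  by apply: cvgN; exact: cvg_id.
have [t] : exists2 t, t \in `[0, b] & h t = 0.
  apply: IVT => //; first exact: continuous_subspaceT.
  by rewrite ge_min le_max h0 hb orbT.
rewrite in_itv /= => /andP[t0 _] ht.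
exists (expR t); first by rewrite -expR0 ler_expR.
have -> : expR t `^ p = expR (p * t) by rewrite /powR gt_eqF ?expR_gt0// expRK.
rewrite -expRN.
have -> : 1 - p * (1 - expR (- t)) = v * expR (- (p * t)).
  by move: ht; rewrite /h; lra.
by rewrite mulrCA -expRD subrr expR0 mulr1.
Qed.

(* Since [(1 + x) (1 - x) <= 1], this follows from Bernoulli's inequality. *)
Lemma powR_bernoulliN (R : realType) (p x : R) : 1 < p -> 0 <= x -> x < 1 ->
  (1 + p * x) * (1 - x) `^ p <= 1.
Proof.
move=> p1 x0 x1.
have p0 : 0 <= p by rewrite ltW// (lt_trans _ p1).
have y0 : 0 <= 1 - x by rewrite subr_ge0 ltW.
apply: (@le_trans _ _ ((1 + x) `^ p * (1 - x) `^ p)).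
  by apply: ler_wpM2r; [exact: powR_ge0|apply: powR_bernoulli => //; lra].
rewrite -powRM//; last by rewrite addr_ge0.
apply: (@le_trans _ _ (1 `^ p)); last by rewrite powR1.
have xx : 0 <= x * x by rewrite mulr_ge0.
rewrite ge0_ler_powR ?nnegrE//; first by rewrite mulr_ge0// addr_ge0.
by lra.
Qed.

Section parameters.
Context {R : realType}.
Variables (p v u : R).
Hypotheses (p1 : 1 < p) (v0 : 0 < v) (u1 : 1 <= u).
Let k := 1 - u^-1.
Let w := 1 - p * k.
Hypothesis vE : v = u `^ p * w.

Let u0 : 0 < u. Proof. exact: lt_le_trans u1. Qed.
Let p0 : 0 < p. Proof. exact: lt_trans p1. Qed.

Lemma growth_ratio_ge0 : 0 <= k.
Proof. by rewrite subr_ge0 invf_le1. Qed.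

Lemma growth_ratio_lt1 : k < 1.
Proof. by rewrite ltrBlDr ltrDl invr_gt0. Qed.

Lemma growth_slope_gt0 : 0 < w.
Proof. by move: v0; rewrite vE pmulr_rgt0// powR_gt0. Qed.

Variable alpha : R.
Hypotheses (alpha0 : 0 < alpha) (alpha1 : alpha < 1).

Let rho := (1 - alpha * k)^-1.
Let q := (1 - alpha) * rho `^ p.

Let ak_ge0 : 0 <= alpha * k.
Proof. by rewrite mulr_ge0 ?growth_ratio_ge0// ltW. Qed.

Let ak_lt1 : alpha * k < 1.
Proof.
apply: le_lt_trans growth_ratio_lt1.
by rewrite ler_piMl ?growth_ratio_ge0// ltW.
Qed.

Let rhop : rho `^ p = ((1 - alpha * k) `^ p)^-1.
Proof. by rewrite /rho -powR_inv1 ?subr_ge0 ?ltW// powRAC powR_inv1// powR_ge0. Qed.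

Let W0 : 0 < (1 - alpha * k) `^ p.
Proof. by rewrite powR_gt0// subr_gt0. Qed.

Let W1 : 1 - p * (alpha * k) <= (1 - alpha * k) `^ p.
Proof.
rewrite -mulrN; apply: powR_bernoulli => //.
by rewrite lerN2 ltW.
Qed.

Lemma growth_factor_gt0 : 0 < rho.
Proof. by rewrite invr_gt0 subr_gt0. Qed.

(** This normalization dictates rho, since alpha/u + 1 - alpha = 1 - alpha k. *)
Lemma growth_mean1 : alpha * (rho / u) + (1 - alpha) * rho = 1.
Proof.
rewrite (_ : u^-1 = 1 - k); last by rewrite /k opprB addrC subrK.
have : (1 - alpha * k) * rho = 1 by rewrite mulfV// gt_eqF// subr_gt0.
by lra.
Qed.

(* [rho / u] is the average at the next step divided by [u].  Dividing the
   average at the current step instead would reverse this inequality, and the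
   p-th integral of the construction could exceed its target. *)
Lemma growth_fixpoint : alpha * (rho / u) `^ p + q * v^-1 <= v^-1.
Proof.
rewrite /q powRM ?(ltW growth_factor_gt0) ?invr_ge0 ?(ltW u0)//.
rewrite -[u^-1]powR_inv1 ?(ltW u0)// powRAC powR_inv1 ?powR_ge0// rhop.
have vw : v^-1 * w = (u `^ p)^-1.
  by rewrite vE; field; rewrite !gt_eqF ?powR_gt0 ?growth_slope_gt0.
(* After multiplication by (1 - alpha k)^p the left side is (1 - p alpha k)/v, so that Bernoulli's
   inequality [W1] concludes. *)
rewrite -vw -(ler_pM2l W0).
have -> : (1 - alpha * k) `^ p * (alpha * (((1 - alpha * k) `^ p)^-1 * (v^-1 * w)) +
    (1 - alpha) / (1 - alpha * k) `^ p / v) = (1 - p * (alpha * k)) * v^-1.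
  by rewrite /w; field; rewrite !gt_eqF.
by rewrite ler_pM2r ?invr_gt0.
Qed.

(** By Bernoulli, (1 - alpha k)^p >= 1 - p alpha k = 1 - alpha + alpha w > 1 - alpha. *)
Lemma moment_ratio_lt1 : q < 1.
Proof.
rewrite /q rhop ltr_pdivrMr// mul1r; apply: lt_le_trans W1.
have : 0 < alpha * w by rewrite mulr_gt0// growth_slope_gt0.
by rewrite /w; lra.
Qed.

(** Bounds the limit moment alpha/(1 - q) below by 1/(w + alpha), which approaches 1/w for small
    alpha. *)
Lemma moment_ratio_ge : 1 - q <= alpha * (w + alpha).
Proof.
have : (1 + p * (alpha * k)) <= rho `^ p.
  rewrite rhop -[leRHS]mul1r ler_pdivlMr//.
  by apply: powR_bernoulliN.
rewrite -(ler_pM2l (_ : 0 < 1 - alpha)) ?subr_gt0// -/q => h.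
have : 0 <= alpha * alpha * w by rewrite !mulr_ge0 ?ltW// growth_slope_gt0.
by rewrite /w; move: h; lra.
Qed.

Lemma momentE N : (1 - q) * moment p alpha rho N = alpha * (1 - q ^+ N).
Proof.
elim: N => [|N IH]; first by rewrite expr0 subrr !mulr0.
by rewrite /= -/q mulrDr mulrCA IH exprS; ring.
Qed.

End parameters.

Lemma moment_approx (R : realType) (p v u : R) (eps : R) :
  1 < p -> 0 < v -> 1 <= u -> v = u `^ p * (1 - p * (1 - u^-1)) -> 0 < eps ->
  exists (alpha : R) (N : nat), [/\ 0 < alpha, alpha < 1 &
    (1 - p * (1 - u^-1))^-1 - eps <=
    moment p alpha (1 - alpha * (1 - u^-1))^-1 N].
Proof.
move=> p1 v0 u1 vE eps0; set k := 1 - u^-1; set w := 1 - p * k.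
have w0 : 0 < w by exact: (growth_slope_gt0 v0 u1 vE).
have ew : 0 < eps * w ^+ 2 by rewrite mulr_gt0// exprn_gt0.
(* The second entry makes 1/w - 1/(w + alpha) = alpha/(w (w + alpha)) at most eps/2; the first keeps
   alpha below 1. The other eps/2 pays for the geometric tail q^N L. *)
pose alpha := Num.min 2^-1 (eps * w ^+ 2 / 2).
have a0 : 0 < alpha by rewrite lt_min invr_gt0 ltr0n divr_gt0.
have a1 : alpha < 1 by rewrite gt_min invf_lt1// ltr1n.
have aw : alpha <= eps * w ^+ 2 / 2 by rewrite ge_min lexx orbT.
pose rho := (1 - alpha * k)^-1; pose q := (1 - alpha) * rho `^ p.
have q1 : q < 1 by exact: (moment_ratio_lt1 p1 v0 u1 vE a0 a1).
have q1' : 0 < 1 - q by rewrite subr_gt0.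
have q0 : 0 <= q by rewrite mulr_ge0 ?powR_ge0// subr_ge0 ltW.
pose L := alpha / (1 - q).
have L0 : 0 < L by rewrite divr_gt0.
have wa : 0 < w + alpha by exact: addr_gt0.
have Lw : w^-1 - eps / 2 <= L.
  apply: (@le_trans _ _ (w + alpha)^-1).
    rewrite lerBlDr -lerBlDl.
    have -> : w^-1 - (w + alpha)^-1 = alpha / (w * (w + alpha)).
      by field; rewrite !gt_eqF.
    rewrite ler_pdivrMr ?mulr_gt0//; apply: (le_trans aw).
    have : 0 <= eps / 2 * (w * alpha) by rewrite !mulr_ge0// ltW// ?divr_gt0.
    by rewrite expr2; lra.
  rewrite ler_pdivlMr// mulrC ler_pdivrMr//.
  exact: (moment_ratio_ge p1 v0 u1 vE a0 a1).
have [N HN] : exists N, q ^+ N * L <= eps / 2.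
  have : (q ^+ n * L) @[n --> \oo] --> 0 * L.
    by apply: cvgMr_tmp; apply: cvg_expr; rewrite ger0_norm.
  rewrite mul0r => /cvgrPdist_le /(_ (eps / 2)) []; first by rewrite divr_gt0.
  move=> N _ /(_ N (leqnn N)); rewrite sub0r normrN ger0_norm; first by exists N.
  by rewrite mulr_ge0 ?exprn_ge0// ltW.
exists alpha, N; split=> //; rewrite -/rho.
have -> : moment p alpha rho N = L - q ^+ N * L.
  apply: (@mulfI _ (1 - q)); first by rewrite gt_eqF.
  by rewrite (momentE p u alpha N) /L -/k -/rho -/q; field; rewrite gt_eqF.
by move: Lw HN; lra.
Qed.

(** * Almost extremal functions and the theorem *)

Lemma integral_minorant_le_maxop (d : measure_display) (X : measurableType d)
  (R : realType) (mu : probability X R) (C : set X -> set (set X)) (p : R)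
  (phi g : X -> R) :
  is_tree mu C -> 1 < p -> measurable_fun setT phi -> (forall x, 0 <= phi x) ->
  (\int[mu]_x (phi x)%:E < +oo)%E ->
  measurable_fun setT g -> (forall x, 0 <= g x) ->
  (forall x, exists Q, [/\ dyadic_tree C Q, Q x & g x <= avg mu Q phi]) ->
  (\int[mu]_x (g x `^ p)%:E <= \int[mu]_x (maxop mu (dyadic_tree C) phi x `^ p))%E.
Proof.
move=> tC p1 mphi phi0 intphi mg g0 gQ.
have p0 : 0 <= p by rewrite ltW// (lt_trans _ p1).
have gM x : ((g x)%:E <= maxop mu (dyadic_tree C) phi x)%E.
  have [Q [TQ Qx gx]] := gQ x.
  by apply: (le_trans _ (avg_le_maxop tC mphi phi0 intphi TQ Qx)); rewrite lee_fin.
apply: ge0_le_integral => //.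
- by move=> x _; rewrite lee_fin powR_ge0.
- exact/measurable_EFinP/measurable_powR_comp.
(* The maximal function is measurable as a pointwise limit of running maxima. *)
- apply: (emeasurable_fun_cvg (fun m x => (runmax mu C phi m x `^ p)%:E)).
    move=> m; apply/measurable_EFinP/measurable_powR_comp.
    exact: (measurable_runmax tC).
  by move=> x _; exact: (cvg_runmax_powR tC p1 mphi phi0 intphi).
- move=> x _; rewrite -poweR_EFin; apply: gt0_ler_poweR => //.
  + by rewrite in_itv /= leey andbT lee_fin.
  + rewrite in_itv /= leey andbT; apply: le_trans (gM x).
    by rewrite lee_fin.
Qed.

(** An extremal pair on the whole space with s = sstar = F/f^p, multiplied by f. As f^p/w = u^p F
    for w = 1 - p (1 - 1/u), the lower bound is u^p F - eps f^p, in accordance with phi close to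
    M/u. *)
Lemma exists_almost_extremal (d : measure_display) (X : measurableType d)
  (R : realType) (mu : probability X R) (C : set X -> set (set X))
  (p f F u eps : R) : is_tree mu C -> 1 < p -> 0 < f -> f `^ p <= F -> 1 <= u ->
  f `^ p / F = u `^ p * (1 - p * (1 - u^-1)) -> 0 < eps ->
  exists phi : X -> R, [/\ measurable_fun setT phi, forall x, 0 <= phi x,
    (\int[mu]_x (phi x)%:E = f%:E)%E, (\int[mu]_x (phi x `^ p)%:E = F%:E)%E &
    ((f `^ p * ((1 - p * (1 - u^-1))^-1 - eps))%:E <=
      \int[mu]_x (maxop mu (dyadic_tree C) phi x `^ p))%E].
Proof.
move=> tC p1 f0 fF u1 vE eps0.
have u0 : 0 < u by exact: lt_le_trans u1.
have fp0 : 0 < f `^ p by exact: powR_gt0.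
have F0 : 0 < F by exact: lt_le_trans fF.
have v0 : 0 < f `^ p / F by exact: divr_gt0.
have [alpha [N [a0 a1 mN]]] := moment_approx p1 v0 u1 vE eps0.
set rho := (1 - alpha * (1 - u^-1))^-1 in mN.
have rho0 : 0 < rho := growth_factor_gt0 u1 a1.
have c0 : 0 < rho / u by exact: divr_gt0.
have sstar1 : 1 <= (f `^ p / F)^-1.
  by rewrite invf_div ler_pdivlMr// mul1r.
have TX : dyadic_tree C setT by exists 0%N.
have [psi [g [[mpsi mg] [psi0 g0] [psi1 psip] gp gQ]]] :=
  extremal_pair_exists tC p1 a0 a1 rho0 c0 (growth_mean1 u1 a1) sstar1
    (growth_fixpoint p1 v0 u1 vE a1) N (lexx _) TX.
have muT : mu setT = 1%E := probability_setT mu.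
have mZ (h : X -> R) : measurable_fun setT h -> measurable_fun setT (fun x => f * h x).
  by move=> mh; exact: measurable_funM.
have intZ (a : R) (h : X -> R) (D : set X) : measurable D -> 0 <= a ->
    measurable_fun setT h -> (forall x, 0 <= h x) ->
    (\int[mu]_(x in D) (a * h x)%:E = a%:E * \int[mu]_(x in D) (h x)%:E)%E.
  move=> mD a0' mh h0; under eq_integral do rewrite EFinM.
  rewrite ge0_integralZl_EFin//; first by move=> x _; rewrite lee_fin.
  by apply/measurable_EFinP; exact: measurable_funS mh.
have powZ (h : X -> R) : measurable_fun setT h -> (forall x, 0 <= h x) ->
    (\int[mu]_x ((f * h x) `^ p)%:E = (f `^ p)%:E * \int[mu]_x (h x `^ p)%:E)%E.
  move=> mh h0; rewrite -intZ ?(ltW fp0)//.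
  - by under eq_integral do rewrite powRM ?(ltW f0)//.
  - exact: measurable_powR_comp.
  - by move=> x; exact: powR_ge0.
have intf : (\int[mu]_x (f * psi x)%:E = f%:E)%E.
  by rewrite intZ ?(ltW f0)// psi1 [X in (_ * X)%E]muT mule1.
exists (fun x => f * psi x); split=> //.
- exact: mZ.
- by move=> x; rewrite mulr_ge0// ltW.
- rewrite powZ// psip [X in (_ * (_ * X))%E]muT mule1 -EFinM invf_div.
  by congr (_%:E); field; rewrite gt_eqF.
- apply: (@le_trans _ _ (\int[mu]_x ((f * g x) `^ p)%:E)%E).
    rewrite powZ// gp [X in (_ * (_ * X))%E]muT mule1 -EFinM lee_fin.
    by rewrite ler_pM2l.
  apply: integral_minorant_le_maxop => //.
  + exact: mZ.
  + by move=> x; rewrite mulr_ge0// ltW.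
  + by rewrite intf ltry.
  + exact: mZ.
  + by move=> x; rewrite mulr_ge0// ltW.
  + move=> x; have [Q [TQ Qx _ gx]] := gQ x I.
    exists Q; split=> //; rewrite /avg intZ ?(ltW f0)//; last first.
      exact: (tree_measurable tC TQ).
    by rewrite fineZ// mulrCA ler_pM2l.
Qed.

Theorem theorem1p3 (d : measure_display) (X : measurableType d) (R : realType)
  (mu : probability X R) (C : set X -> set (set X))
  (p f F : R) :
  nonatomic mu -> is_tree mu C ->
  1 < p -> 0 < f -> 0 < f `^ p -> f `^ p <= F ->
  (forall (beta gamma k : R) (K : set X) (phi : X -> R),
     0 <= gamma -> gamma <= beta ->
     measurable K -> 0 < k <= 1 -> mu K = k%:E ->
     measurable_fun setT phi -> (forall x, 0 <= phi x) ->
     (\int[mu]_x (phi x)%:E = f%:E)%E ->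
     (\int[mu]_x ((phi x) `^ p)%:E = F%:E)%E ->
     (star_rhs mu (dyadic_tree C) p f beta gamma K phi <= F%:E)%E)
  /\
  (forall k : R, 0 < k <= 1 ->
     exists beta gamma : R, 0 <= gamma /\ gamma <= beta /\
     exists (K : nat -> set X) (phi : nat -> X -> R),
       (forall n, measurable (K n)) /\
       (mu \o K) @ \oo --> k%:E /\
       (forall n, measurable_fun setT (phi n)) /\
       (forall n x, 0 <= phi n x) /\
       (forall n, \int[mu]_x (phi n x)%:E = f%:E)%E /\
       (forall n, \int[mu]_x ((phi n x) `^ p)%:E = F%:E)%E /\
       (fun n => F%:E - star_rhs mu (dyadic_tree C) p f beta gamma (K n) (phi n))%E
         @ \oo --> 0%E).
Proof.
move=> _ tC p1 f0 fp0 fF; split.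
  move=> beta gamma k K phi g0 gb mK _ _ mphi phi0 phif phiF.
  exact: star_inequality.
move=> k /andP[k0 k1].
have F0 : 0 < F by exact: lt_le_trans fF.
have [u u1 vE] : exists2 u : R, 1 <= u &
    f `^ p / F = u `^ p * (1 - p * (1 - u^-1)).
  by apply: exists_growth => //; [exact: divr_gt0|rewrite ler_pdivrMr// mul1r].
have u0 : 0 < u by exact: lt_le_trans u1.
have w0 := growth_slope_gt0 (divr_gt0 fp0 F0) u1 vE.
have TX : dyadic_tree C setT by exists 0%N.
have muT : mu setT = 1%E := probability_setT mu.
(* A union of cells of measure exactly k, so that the sequence of sets can be constant. *)
have [G [G0 _ GE]] : exists G : nat -> set X, [/\
    forall n, G n = set0 \/ dyadic_tree C (G n) /\ G n `<=` setT,
    trivIset setT G & mu (\bigcup_n G n) = k%:E].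
  by apply: (split_tree tC TX); rewrite muT (ltW k0).
have mG : measurable (\bigcup_n G n).
  apply: bigcup_measurable => n _; have [->//|[TG _]] := G0 n.
  exact: (tree_measurable tC TG).
have eps0 n : 0 < n.+1%:R^-1 :> R by [].
have /choice[phi phiP] := fun n => exists_almost_extremal tC p1 f0 fF u1 vE (eps0 n).
exists (u - 1), 0; split=> //; split; first by rewrite subr_ge0.
exists (fun=> \bigcup_n G n), phi; split; first by [].
split; first by rewrite /comp GE; exact: cvg_cst.
split; first by move=> n; have [] := phiP n.
split; first by move=> n; have [] := phiP n.
split; first by move=> n; have [] := phiP n.
split; first by move=> n; have [] := phiP n.
pose S n := star_rhs mu (dyadic_tree C) p f (u - 1) 0 (\bigcup_n G n) (phi n).
change ((F%:E - S n)%E @[n --> \oo] --> 0%E).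
(* The coefficient of the integral of M^p times f^p: the defect is at most e/(n+1). *)
pose e := (p - 1) * (u - 1) / u `^ p * f `^ p.
have c0 : 0 <= (p - 1) * (u - 1) / u `^ p.
  by rewrite divr_ge0 ?powR_ge0// mulr_ge0 ?subr_ge0// ltW.
have SF n : (S n <= F%:E)%E.
  have [mphi phi0 phif phiF _] := phiP n.
  by apply: star_inequality => //; rewrite subr_ge0.
have SL n : ((F - e * n.+1%:R^-1)%:E <= S n)%E.
  have [mphi phi0 phif phiF phiM] := phiP n.
  rewrite /S /star_rhs addr0 powR1 invr1 subrr mul0e add0e subrK mulr0 mul0r mul0e sube0.
  have -> : F - e * n.+1%:R^-1 = (p - 1) * (u - 1) / u `^ p *
      (f `^ p * ((1 - p * (1 - u^-1))^-1 - n.+1%:R^-1)) + f `^ p / u `^ (p - 1).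
    have fE : f `^ p = F * (u `^ p * (1 - p * (1 - u^-1))).
      by rewrite -vE mulrCA mulfV ?mulr1// gt_eqF.
    have uE : u `^ p = u * u `^ (p - 1) by rewrite mulr_powRB1 ?(ltW u0)// (lt_trans _ p1).
    rewrite /e fE uE; move: w0; set r := n.+1%:R^-1 => w0.
    have up0 : 0 < u `^ (p - 1) by exact: powR_gt0.
    set w := 1 - p * (1 - u^-1) in w0 *.
    (* This gives u w + (p-1)(u-1) = 1, so the main terms add up to exactly F. *)
    have wE : u * w = u - p * (u - 1) by rewrite /w; field; rewrite gt_eqF.
    transitivity (F * (u * w + (p - 1) * (u - 1)) - (p - 1) * (u - 1) * F * w * r).
      rewrite wE; field; rewrite ?gt_eqF//.
    by clearbody w; field; rewrite !gt_eqF.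
  rewrite EFinD leeD2r// EFinM; apply: lee_wpmul2l; last exact: phiM.
  by rewrite lee_fin.
have sandwich : \forall n \near \oo,
    (0 <= F%:E - S n <= (e * n.+1%:R^-1)%:E)%E.
  apply: nearW => n; rewrite sube_ge0; last by rewrite orbT.
  rewrite SF /=; have := leeB (lexx F%:E) (SL n); rewrite -EFinB => /le_trans; apply.
  by rewrite lee_fin subKr.
apply: (squeeze_cvge sandwich); first exact: cvg_cst.
apply: cvg_EFin; first exact: nearW.
rewrite -[X in _ --> X](mulr0 e); apply: cvgMl_tmp; exact: cvg_harmonic.
Qed.
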